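(* Let $\rho_1(x)=\frac{\pi}{2}\operatorname{sech}^2(\pi x)$ and for $\ell\ge2$ let $\rho_\ell(x)=\int_{-\infty}^\infty\rho_{\ell-1}(y)\rho_1(x-y)\,dy$. For a positive integer $\ell$ and $b>0$ set $$z_\ell(b)=\int_0^\infty\log(1+bu^2)\rho_\ell(u)\,du,$$ and for real $x\ne\ell/2$ set $y_\ell(x)=z_\ell\big((x-\ell/2)^{-2}\big)$. Then for every positive integer $\ell$ and every real $x\neq \ell/2$, $$\ell(\ell+1)y_{\ell+2}(x+1)=x(x-\ell)y_\ell''(x)+2(\ell+1)\left(x-\frac{\ell}{2}\right)y_\ell'(x)+\ell(\ell+1)y_\ell(x)+\frac{\ell^2}{4\left(x-\frac{\ell}{2}\right)^2}.$$ *)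

(* Defs.v *)
From Stdlib Require Import Reals.
From Coquelicot Require Import Coquelicot.
Open Scope R_scope.

Definition rho1 (x : R) : R := (PI / 2) * / (cosh (PI * x)) ^ 2.

Definition int_R (f : R -> R) : R :=
  RInt_gen f (Rbar_locally m_infty) (Rbar_locally p_infty).

(* rho_aux n = rho_{n+1} *)
Fixpoint rho_aux (n : nat) : R -> R :=
  match n with
  | O => rho1
  | S m => fun x => int_R (fun y => rho_aux m y * rho1 (x - y))
  end.

(* rho l for l >= 1 (rho 0 is an unused dummy) *)
Definition rho (l : nat) : R -> R :=
  match l with
  | O => fun _ => 0
  | S n => rho_aux n
  end.

Definition z (l : nat) (b : R) : R :=
  RInt_gen (fun u => ln (1 + b * u ^ 2) * rho l u) (at_point 0) (Rbar_locally p_infty).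

Definition y (l : nat) (x : R) : R := z l (/ (x - INR l / 2) ^ 2).

(* Main.v *)
Require Import Defs.
From Stdlib Require Import Reals.
From Coquelicot Require Import Coquelicot.
From Stdlib Require Import Lra Lia Psatz FunctionalExtensionality.
Open Scope R_scope.

(* Put w = x - l/2, which is unchanged under (l, x) -> (l + 2, x + 1), and let U_n have density
   rho_n (U_0 = 0). Then y_n(x) = G_n(w) - log |w| with G_n(w) = E log |w + i U_n|, and the claim
   becomes
     n(n+1) G_{n+2} = (w^2 - n^2/4) G_n'' + 2(n+1) w G_n' + n(n+1) G_n - (2n+1).
   The residue of log(w + z) / sinh^2 at its double pole in the strip |Re z| < 1/2 gives the
   difference equation G_{n+1}(w + 1/2) - G_{n+1}(w - 1/2) = G_n'(w) for w > 1/2. Here the contour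
   integral is done in real terms: after an integration by parts the kernel is coth, the two
   vertical lines Re z = +-a are moved together from a = 1/2 to a = 0, and in the limit the kernel
   is a Poisson kernel.
   By induction, every identity in play has a defect that is 1-periodic, thanks to the difference
   equation, and tends to 0 as w -> +oo, so that it vanishes. *)

(** * Improper integrals dominated by a Cauchy density *)

(** For [w > 0], G_n' is the Laplace transform in [t] of phi_n = [(s / sinh s)^n] with [s = t / 2].
    In this picture a unit difference is multiplication by [- 2 sinh s], the mean over [w + 1/2] and
    [w - 1/2] is multiplication by [cosh s], and multiplication by [w] is, up to boundary terms, a
    derivative in [t]. The differentiated claim thus expresses phi_{n+2} through phi_n and its first
    two derivatives, and it splits into two first-order relations, one for each step of [n]. These
    are proved for G_n itself, and no transform is ever inverted. Since U_{n+1} is the sum of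
    independent copies of U_n and U_1, Fubini reduces the difference equation for all [n] to a
    single logistic average with a parameter [v]. Half shifts force [w > 1/2], because the segment
    from [w - 1/2] to [w + 1/2] has to avoid the singularity at 0. The final identity contains no
    half shift, so it reaches every [w > 0], and then every [w <> 0] by evenness. All limits are
    taken with explicit rates against [lor], in place of dominated convergence. *)

Definition lor (u : R) : R := / (1 + u ^ 2).

Lemma lor_pos (u : R) : 0 < lor u.
Proof. apply Rinv_0_lt_compat. nra. Qed.

Lemma lor_le_1 (u : R) : lor u <= 1.
Proof. unfold lor. rewrite <- Rinv_1. apply Rinv_le_contravar; nra. Qed.

Lemma lor_opp (u : R) : lor (- u) = lor u.
Proof. unfold lor. f_equal. ring. Qed.

(** This is [1 + (v + t)^2 <= 2 (1 + v^2) (1 + t^2)]. With [t = u - v] it recovers decay in [u] from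
    decay in [v] and in [u - v], which controls convolutions and translates. *)
Lemma lor_mul_le (v t : R) : lor v * lor t <= 2 * lor (v + t).
Proof.
  unfold lor.
  assert (0 < 1 + v ^ 2) by nra. assert (0 < 1 + t ^ 2) by nra.
  assert (0 < 1 + (v + t) ^ 2) by (assert (h := pow2_ge_0 (v + t)); lra).
  rewrite <- Rinv_mult.
  apply Rmult_le_reg_l with ((1 + v ^ 2) * (1 + t ^ 2)); [nra|].
  rewrite Rinv_r by (apply Rgt_not_eq; nra).
  apply Rmult_le_reg_r with (1 + (v + t) ^ 2); [assumption|].
  replace ((1 + v ^ 2) * (1 + t ^ 2) * (2 * / (1 + (v + t) ^ 2)) * (1 + (v + t) ^ 2))
    with (2 * ((1 + v ^ 2) * (1 + t ^ 2))) by (field; lra).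
  nra.
Qed.

Lemma is_derive_atan_lor (u : R) : is_derive atan u (lor u).
Proof. apply is_derive_Reals, derivable_pt_lim_atan. Qed.

Lemma continuous_of_is_derive (f : R -> R) (x d : R) : is_derive f x d -> continuous f x.
Proof. intros H. apply (ex_derive_continuous f). now exists d. Qed.

Lemma continuous_lor (u : R) : continuous lor u.
Proof.
  apply (ex_derive_continuous lor). unfold lor. auto_derive. nra.
Qed.

Lemma ex_RInt_cont (f : R -> R) (a b : R) : (forall x, continuous f x) -> ex_RInt f a b.
Proof. intros H. apply (ex_RInt_continuous f). auto. Qed.

Lemma RInt_lor (a b : R) : RInt lor a b = atan b - atan a.
Proof.
  apply (is_RInt_unique lor). apply (is_RInt_derive atan lor).
  - intros. apply is_derive_atan_lor.
  - intros. apply continuous_lor.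
Qed.

(** [atan b < pi / 2 = atan n + atan (/ n)], and [atan] has slope at most 1. *)
Lemma atan_tail (n b : R) : 0 < n -> n <= b -> 0 <= atan b - atan n <= / n.
Proof.
  intros Hn Hb. split.
  - destruct Hb as [Hb| ->]; [|lra]. apply atan_increasing in Hb. lra.
  - assert (Hi := Rinv_0_lt_compat _ Hn).
    assert (E := atan_inv n Hn).
    destruct (MVT_gen atan 0 (/ n) lor) as (c & _ & Hc).
    + intros. apply is_derive_atan_lor.
    + intros. apply derivable_continuous_pt, derivable_pt_atan.
    + rewrite atan_0 in Hc. assert (H1 := lor_le_1 c).
      assert (H2 := proj2 (atan_bound b)). nra.
Qed.

Lemma atan_diff_le (a b : R) : atan b - atan a <= PI.
Proof. assert (H := atan_bound a). assert (H' := atan_bound b). lra. Qed.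

(** The explicit constant gives each improper integral the truncation error [2 C / n], so that
    equalities of integrals follow from inequalities of order [1 / n] between proper ones. *)
Definition dom (C : R) (f : R -> R) : Prop :=
  (forall x, continuous f x) /\ (forall x, Rabs (f x) <= C * lor x).

Lemma dom_nonneg (C : R) (f : R -> R) : dom C f -> 0 <= C.
Proof.
  intros [_ H]. specialize (H 0). assert (H1 := lor_pos 0).
  assert (H2 := Rabs_pos (f 0)). nra.
Qed.

Lemma dom_RInt (C : R) (f : R -> R) (a b : R) :
  dom C f -> a <= b -> Rabs (RInt f a b) <= C * (atan b - atan a).
Proof.
  intros [Hc Hb] Hab. rewrite <- RInt_lor.
  apply Rle_trans with (RInt (fun t => C * lor t) a b).
  - apply Rle_trans with (1 := abs_RInt_le f a b Hab (ex_RInt_cont _ _ _ Hc)).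
    apply RInt_le; auto.
    + apply ex_RInt_cont. intros x. apply continuous_comp; [apply Hc|].
      apply continuous_Rabs.
    + apply ex_RInt_cont. intros x.
      apply (continuous_scal_r C lor), continuous_lor.
  - right. apply (RInt_scal lor a b C), ex_RInt_cont, continuous_lor.
Qed.

Lemma RInt_Chasles_R (f : R -> R) (a b c : R) : (forall x, continuous f x) ->
  RInt f a c = RInt f a b + RInt f b c.
Proof.
  intros H. symmetry. apply (RInt_Chasles f a b c); apply ex_RInt_cont; auto.
Qed.

Lemma dom_tail (C : R) (f : R -> R) (n a b : R) :
  dom C f -> 0 < n -> a <= - n -> n <= b ->
  Rabs (RInt f a b - RInt f (- n) n) <= 2 * C / n.
Proof.
  intros Hd Hn Ha Hb. assert (HC := dom_nonneg _ _ Hd).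
  rewrite (RInt_Chasles_R f a (- n) b), (RInt_Chasles_R f (- n) n b) by apply Hd.
  replace (_ - _) with (RInt f a (- n) + RInt f n b) by ring.
  apply Rle_trans with (1 := Rabs_triang _ _).
  assert (H1 := dom_RInt _ _ _ _ Hd Ha). assert (H2 := dom_RInt _ _ _ _ Hd Hb).
  assert (H3 := proj2 (atan_tail n b Hn Hb)).
  assert (H4 := proj2 (atan_tail n (- a) Hn ltac:(lra))).
  rewrite atan_opp in H1, H4. unfold Rdiv. nra.
Qed.

Notation is_int_R f l := (is_RInt_gen f (Rbar_locally m_infty) (Rbar_locally p_infty) l).

(** [int_R] says nothing about [f] until convergence is known; it follows here from the Cauchy
    criterion and [dom_tail]. *)
Lemma dom_is_int_R (C : R) (f : R -> R) : dom C f -> is_int_R f (int_R f).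
Proof.
  intros Hd. apply (RInt_gen_correct f).
  assert (HC := dom_nonneg _ _ Hd).
  assert (H : exists l, filterlim (fun ab : R * R => RInt f (fst ab) (snd ab))
     (filter_prod (Rbar_locally m_infty) (Rbar_locally p_infty)) (locally l)).
  { apply filterlim_locally_cauchy. intros [eps Heps].
    (* Two truncations beyond [M] differ by at most [4 C / M]. The [+ 1] keeps [M] positive for
       [C = 0] and makes [4 C / M < eps] strict. *)
    set (M := 4 * C / eps + 1).
    assert (HM : 0 < M).
    { unfold M. assert (0 <= 4 * C / eps); [|lra].
      apply Rmult_le_pos; [lra|]. left. now apply Rinv_0_lt_compat. }
    assert (HMe : 4 * C / M < eps).
    { apply Rmult_lt_reg_r with M; [assumption|]. unfold M.
      replace (4 * C / (4 * C / eps + 1) * (4 * C / eps + 1)) with (4 * C)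
        by (field; unfold M in HM; split; [lra|];
            replace (4 * C + eps) with ((4 * C / eps + 1) * eps) by (field; lra); nra).
      replace (eps * (4 * C / eps + 1)) with (4 * C + eps) by (field; lra). lra. }
    exists (fun ab => fst ab < - M /\ M < snd ab). split.
    - apply (Filter_prod _ _ _ (fun a => a < - M) (fun b => M < b)).
      + now exists (- M).
      + now exists M.
      + auto.
    - intros [a b] [a' b'] [Ha Hb] [Ha' Hb']. simpl in *.
      assert (H1 := dom_tail _ _ M a b Hd HM ltac:(lra) ltac:(lra)).
      assert (H2 := dom_tail _ _ M a' b' Hd HM ltac:(lra) ltac:(lra)).
      change (Rabs (RInt f a' b' - RInt f a b) < eps).
      apply Rabs_le_between in H1. apply Rabs_le_between in H2.
      apply Rabs_lt_between. replace (4 * C / M) with (2 * (2 * C / M)) in HMe by (unfold Rdiv; ring).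
      lra. }
  destruct H as [l Hl]. exists l.
  apply (filterlimi_lim_ext (fun ab => RInt f (fst ab) (snd ab))); [|exact Hl].
  intros [a b]. apply (RInt_correct f). apply ex_RInt_cont, Hd.
Qed.

Lemma int_R_unique (f : R -> R) (l : R) : is_int_R f l -> int_R f = l.
Proof. apply (is_RInt_gen_unique f l). Qed.

Lemma is_int_R_eps (f : R -> R) (l : R) : is_int_R f l ->
  forall eps, 0 < eps -> exists M, forall a b, a < - M -> M < b -> Rabs (RInt f a b - l) < eps.
Proof.
  intros H eps Heps.
  destruct (H _ (locally_ball l (mkposreal eps Heps))) as [P Q [m Hm] [p Hp] HPQ].
  exists (Rmax (- m) p). intros a b Ha Hb.
  destruct (HPQ a b) as (x & Hx & Hxl).
  - apply Hm. assert (h := Rmax_l (- m) p). lra.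
  - apply Hp. assert (h := Rmax_r (- m) p). lra.
  - assert (E : RInt f a b = x) by apply (is_RInt_unique f a b x Hx).
    rewrite E. exact Hxl.
Qed.

Lemma int_R_approx (C : R) (f : R -> R) (n : R) :
  dom C f -> 0 < n -> Rabs (int_R f - RInt f (- n) n) <= 2 * C / n.
Proof.
  intros Hd Hn. apply Rle_plus_epsilon. intros eps Heps.
  destruct (is_int_R_eps _ _ (dom_is_int_R _ _ Hd) eps Heps) as [M HM].
  set (b := Rmax n M + 1).
  assert (h1 := Rmax_l n M). assert (h2 := Rmax_r n M).
  specialize (HM (- b) b ltac:(unfold b; lra) ltac:(unfold b; lra)).
  assert (H := dom_tail _ _ n (- b) b Hd Hn ltac:(unfold b; lra) ltac:(unfold b; lra)).
  replace (int_R f - _) with (- (RInt f (- b) b - int_R f) + (RInt f (- b) b - RInt f (- n) n)) by ring.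
  apply Rle_trans with (1 := Rabs_triang _ _). rewrite Rabs_Ropp. lra.
Qed.

Lemma eq_of_le_div (a b K n0 : R) :
  (forall n, 1 <= n -> n0 <= n -> Rabs (a - b) <= K / n) -> a = b.
Proof.
  intros H. destruct (Req_dec a b) as [E|E]; [assumption|exfalso].
  assert (H0 : 0 < Rabs (a - b)) by (apply Rabs_pos_lt; lra).
  set (e := Rabs (a - b)) in *.
  set (n := Rmax (2 * K / e) (Rmax 1 n0)).
  assert (h1 := Rmax_l (2 * K / e) (Rmax 1 n0)). assert (h2 := Rmax_r (2 * K / e) (Rmax 1 n0)).
  assert (h3 := Rmax_l 1 n0). assert (h4 := Rmax_r 1 n0). fold n in h1, h2.
  specialize (H n ltac:(lra) ltac:(lra)).
  apply Rmult_le_compat_r with (r := n) in H; [|lra].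
  apply Rmult_le_compat_r with (r := e) in h1; [|lra].
  replace (K / n * n) with K in H by (field; lra).
  replace (2 * K / e * e) with (2 * K) in h1 by (field; lra).
  nra.
Qed.

Lemma int_R_eq_of_approx (C K n0 l : R) (f : R -> R) : dom C f ->
  (forall n, 1 <= n -> n0 <= n -> Rabs (RInt f (- n) n - l) <= K / n) -> int_R f = l.
Proof.
  intros Hd H. apply (eq_of_le_div _ _ (2 * C + K) n0). intros n Hn Hn0.
  assert (H1 := int_R_approx C f n Hd ltac:(lra)). specialize (H n Hn Hn0).
  replace (int_R f - l) with (int_R f - RInt f (- n) n + (RInt f (- n) n - l)) by ring.
  apply Rle_trans with (1 := Rabs_triang _ _). unfold Rdiv in *. lra.
Qed.

Lemma dom_plus (C D : R) (f g : R -> R) : dom C f -> dom D g -> dom (C + D) (fun x => f x + g x).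
Proof.
  intros [Hf1 Hf2] [Hg1 Hg2]. split.
  - intros x. apply (continuous_plus f g); auto.
  - intros x. apply Rle_trans with (1 := Rabs_triang _ _).
    specialize (Hf2 x). specialize (Hg2 x). lra.
Qed.

Lemma dom_scal (C k : R) (f : R -> R) : dom C f -> dom (Rabs k * C) (fun x => k * f x).
Proof.
  intros [Hf1 Hf2]. split.
  - intros x. apply (continuous_scal_r k f); auto.
  - intros x. rewrite Rabs_mult, Rmult_assoc.
    apply Rmult_le_compat_l; [apply Rabs_pos|apply Hf2].
Qed.

Lemma int_R_ext (f g : R -> R) : (forall x, f x = g x) -> int_R f = int_R g.
Proof. intros H. f_equal. now apply functional_extensionality. Qed.

Lemma int_R_scal (C k : R) (f : R -> R) : dom C f ->
  int_R (fun x => k * f x) = k * int_R f.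
Proof.
  intros Hf. apply int_R_unique.
  apply (is_RInt_gen_scal f k); eapply dom_is_int_R; eauto.
Qed.

Lemma int_R_minus (C D : R) (f g : R -> R) : dom C f -> dom D g ->
  int_R (fun x => f x - g x) = int_R f - int_R g.
Proof.
  intros Hf Hg. apply int_R_unique.
  apply (is_RInt_gen_minus f g); eapply dom_is_int_R; eauto.
Qed.

Lemma is_int_R_norm (f g : R -> R) (lf lg : R) : (forall x, Rabs (f x) <= g x) ->
  is_int_R f lf -> is_int_R g lg -> Rabs lf <= lg.
Proof.
  intros H Hf Hg.
  assert (Hfilt : filter_prod (Rbar_locally m_infty) (Rbar_locally p_infty)
    (fun ab : R * R => fst ab <= snd ab)).
  { apply (Filter_prod _ _ _ (fun a => a < 0) (fun b => 0 < b));
      [now exists 0|now exists 0|simpl; intros; lra]. }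
  apply (RInt_gen_norm (Fa := Rbar_locally m_infty) (Fb := Rbar_locally p_infty) f g lf lg); auto.
  apply filter_imp with (2 := Hfilt). intros ab _ x _. apply H.
Qed.

Lemma int_R_abs_le (C D : R) (f g : R -> R) : dom C f -> dom D g ->
  (forall x, Rabs (f x) <= g x) -> Rabs (int_R f) <= int_R g.
Proof.
  intros Hf Hg H. apply (is_int_R_norm f g); auto; eapply dom_is_int_R; eauto.
Qed.

Lemma dom_lor : dom 1 lor.
Proof.
  split; [apply continuous_lor|]. intros x. assert (H := lor_pos x).
  rewrite Rabs_pos_eq; lra.
Qed.

Lemma RInt_reflect (f : R -> R) (a b : R) : (forall x, continuous f x) ->
  RInt (fun x => f (- x)) a b = RInt f (- b) (- a).
Proof.
  intros Hc.
  apply (is_RInt_unique (fun x => f (- x))).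
  apply is_RInt_ext with (fun x => opp (opp (f (- x)))).
  { intros x _. apply (opp_opp (f (- x))). }
  rewrite <- (opp_opp (RInt f (- b) (- a))).
  apply (is_RInt_opp (fun x => opp (f (- x)))), (is_RInt_comp_opp f).
  apply (is_RInt_swap f), (RInt_correct f), ex_RInt_cont, Hc.
Qed.

Lemma int_R_opp (C : R) (f : R -> R) : dom C f -> int_R (fun x => f (- x)) = int_R f.
Proof.
  intros Hd.
  assert (Hd' : dom C (fun x => f (- x))).
  { split.
    - intros x. apply (continuous_comp Ropp f); [|apply Hd].
      apply (continuous_opp (fun x : R => x)), continuous_id.
    - intros x. rewrite <- (lor_opp x). apply Hd. }
  apply (int_R_eq_of_approx C (2 * C) 1 _ _ Hd'). intros n Hn _.
  replace (RInt (fun x => f (- x)) (- n) n) with (RInt f (- n) n).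
  - rewrite <- Rabs_Ropp.
    replace (- (RInt f (- n) n - int_R f)) with (int_R f - RInt f (- n) n) by ring.
    apply int_R_approx; [assumption|lra].
  - rewrite RInt_reflect by apply Hd. now rewrite Ropp_involutive.
Qed.

(** The bridge to [z], which integrates over a half-line, whereas densities and convolutions live on
    the whole line. *)
Lemma is_RInt_gen_half (C : R) (f : R -> R) : dom C f -> (forall x, f (- x) = f x) ->
  is_RInt_gen f (at_point 0) (Rbar_locally p_infty) (int_R f / 2).
Proof.
  intros Hd He. assert (Hc := proj1 Hd). unfold is_RInt_gen.
  apply (filterlimi_lim_ext (fun ab => RInt f (fst ab) (snd ab))).
  - intros [a b]. apply (RInt_correct f), ex_RInt_cont, Hc.
  - apply filterlim_locally. intros [eps Heps].
    destruct (is_int_R_eps _ _ (dom_is_int_R _ _ Hd) eps Heps) as [M HM].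
    apply (Filter_prod _ _ _ (fun a => a = 0) (fun b => Rmax 0 M < b)).
    + reflexivity.
    + now exists (Rmax 0 M).
    + intros a b -> Hb. simpl. change (Rabs (RInt f 0 b - int_R f / 2) < eps).
      assert (h1 := Rmax_l 0 M). assert (h2 := Rmax_r 0 M).
      specialize (HM (- b) b ltac:(lra) ltac:(lra)).
      rewrite (RInt_Chasles_R f (- b) 0 b) in HM by assumption.
      assert (E : RInt f (- b) 0 = RInt f 0 b).
      { rewrite <- (RInt_ext (fun x => f (- x))) by (intros; apply He).
        rewrite RInt_reflect, Ropp_0, Ropp_involutive by assumption. reflexivity. }
      rewrite E in HM. apply Rabs_lt_between in HM. apply Rabs_lt_between. lra.
Qed.

(** * Exchange of the order of integration, and differentiation under the integral *)

Lemma continuity_2d_pt_swap (F : R -> R -> R) (u v : R) :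
  continuity_2d_pt F u v -> continuity_2d_pt (fun b a => F a b) v u.
Proof.
  intros H eps. destruct (H eps) as [d Hd]. exists d. intros a b Ha Hb. now apply Hd.
Qed.

Lemma continuous_section (F : R -> R -> R) (u v : R) :
  continuity_2d_pt F u v -> continuous (F u) v.
Proof.
  intros H. apply (filterlim_locally (F u)). intros eps.
  destruct (H eps) as [d Hd]. exists d. intros y Hy. apply Hd; [|exact Hy].
  rewrite Rminus_diag, Rabs_R0. apply cond_pos.
Qed.

Lemma continuous_RInt_section (F : R -> R -> R) (c d x : R) :
  (forall u v, continuity_2d_pt F u v) -> continuous (fun u => RInt (F u) c d) x.
Proof.
  intros HF. revert c d.
  assert (H : forall c d, c <= d -> continuous (fun u => RInt (F u) c d) x).
  2:{ intros c d. destruct (Rle_dec c d) as [Hcd|Hcd]; [now apply H|].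
      apply continuous_ext with (fun u => opp (RInt (F u) d c)).
      - intros u. apply (opp_RInt_swap (F u)), ex_RInt_cont. intros t. apply continuous_section, HF.
      - apply (continuous_opp (fun u => RInt (F u) d c)), H. lra. }
  intros c d Hcd. apply (filterlim_locally (fun u => RInt (F u) c d)). intros [eps Heps].
  assert (He : 0 < eps / (d - c + 1)) by (apply Rdiv_lt_0_compat; lra).
  destruct (uniform_continuity_2d_1d' F c d x (fun t _ => HF x t) (mkposreal _ He)) as [del Hd].
  assert (Hdel := cond_pos del).
  exists del. intros u Hu. apply Rabs_lt_between in Hu. unfold minus, plus, opp in Hu; simpl in Hu.
  change (Rabs (RInt (F u) c d - RInt (F x) c d) < eps).
  assert (Hc : forall w t, continuous (F w) t) by (intros; apply continuous_section, HF).
  rewrite <- (RInt_minus (F u) (F x)) by (apply ex_RInt_cont; auto).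
  apply Rle_lt_trans with ((d - c) * (eps / (d - c + 1))).
  - apply abs_RInt_le_const; [lra| |].
    + apply ex_RInt_cont. intros t. apply (continuous_minus (F u) (F x)); auto.
    + intros t Ht. left. apply Hd; try lra.
      rewrite Rminus_diag, Rabs_R0. apply cond_pos.
  - apply Rmult_lt_reg_r with (d - c + 1); [lra|].
    replace ((d - c) * (eps / (d - c + 1)) * (d - c + 1)) with ((d - c) * eps) by (field; lra).
    nra.
Qed.

(** As functions of the upper endpoint [b], both sides vanish at [b = a] and have the same
    derivative, by differentiation under the integral sign. *)
Lemma RInt_swap_order (F : R -> R -> R) (a b c d : R) :
  (forall u v, continuity_2d_pt F u v) ->
  RInt (fun u => RInt (F u) c d) a b = RInt (fun v => RInt (fun u => F u v) a b) c d.
Proof.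
  intros HF.
  assert (HF' : forall v u, continuity_2d_pt (fun v u => F u v) v u)
    by (intros; apply continuity_2d_pt_swap, HF).
  assert (Hcu : forall v t, continuous (fun u => F u v) t)
    by (intros v t; apply (continuous_section (fun v u => F u v)), HF').
  assert (HD : forall v x, is_derive (fun x => RInt (fun u => F u v) a x) x (F x v)).
  { intros v x. apply (is_derive_RInt (fun u => F u v) _ a).
    - exists (mkposreal 1 Rlt_0_1). intros y _. apply (RInt_correct (fun u => F u v)), ex_RInt_cont, Hcu.
    - apply Hcu. }
  set (Phi := fun x => RInt (fun v => RInt (fun u => F u v) a x) c d).
  assert (HPhi : forall x, is_derive Phi x (RInt (F x) c d)).
  { intros x. unfold Phi.
    rewrite (RInt_ext (F x) (fun v => Derive (fun x => RInt (fun u => F u v) a x) x)).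
    2:{ intros v _. symmetry. apply is_derive_unique, HD. }
    apply (is_derive_RInt_param (fun x v => RInt (fun u => F u v) a x)).
    - exists (mkposreal 1 Rlt_0_1). intros y _ t _. eexists. apply HD.
    - intros t _. apply continuity_2d_pt_ext with F; [|apply HF].
      intros u v. symmetry. apply is_derive_unique, HD.
    - exists (mkposreal 1 Rlt_0_1). intros y _.
      apply ex_RInt_cont. intros v.
      apply (continuous_RInt_section (fun v u => F u v)), HF'. }
  change (RInt (fun u => RInt (F u) c d) a b = Phi b).
  transitivity (Phi b - Phi a).
  - apply is_RInt_unique, (is_RInt_derive Phi).
    + intros; apply HPhi.
    + intros x _. now apply continuous_RInt_section.
  - assert (E : Phi a = 0).
    { unfold Phi. rewrite (RInt_ext _ (fun _ => 0)).
      - rewrite RInt_const. apply Rmult_0_r.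
      - intros v _. apply (RInt_point a (fun u => F u v)). }
    rewrite E. apply Rminus_0_r.
Qed.

Lemma continuity_2d_pt_fst (f : R -> R) (u v : R) : continuous f u ->
  continuity_2d_pt (fun a _ => f a) u v.
Proof.
  intros H. apply (continuity_1d_2d_pt_comp f (fun a _ => a)); [|apply continuity_2d_pt_id1].
  now apply continuity_pt_filterlim.
Qed.

Lemma continuity_2d_pt_snd (f : R -> R) (u v : R) : continuous f v ->
  continuity_2d_pt (fun _ b => f b) u v.
Proof.
  intros H. apply (continuity_1d_2d_pt_comp f (fun _ b => b)); [|apply continuity_2d_pt_id2].
  now apply continuity_pt_filterlim.
Qed.

Lemma int_R_bound (C B : R) (f : R -> R) : dom C f ->
  (forall a b, a <= b -> Rabs (RInt f a b) <= B) -> Rabs (int_R f) <= B.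
Proof.
  intros Hd H. apply Rle_plus_epsilon. intros eps Heps.
  destruct (is_int_R_eps _ _ (dom_is_int_R _ _ Hd) eps Heps) as [M HM].
  set (b := Rmax 0 M + 1). assert (h1 := Rmax_l 0 M). assert (h2 := Rmax_r 0 M).
  specialize (HM (- b) b ltac:(unfold b; lra) ltac:(unfold b; lra)).
  specialize (H (- b) b ltac:(unfold b; lra)).
  apply Rabs_le_between in H. apply Rabs_lt_between in HM. apply Rabs_le_between. lra.
Qed.

(* By the product bound, truncation to the square [[-n, n]^2] costs [O(1/n)]. *)
Lemma int_R_swap (C : R) (F : R -> R -> R) :
  (forall u v, continuity_2d_pt F u v) ->
  (forall u v, Rabs (F u v) <= C * lor u * lor v) ->
  (forall u, continuous (fun u => int_R (F u)) u) ->
  (forall v, continuous (fun v => int_R (fun u => F u v)) v) ->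
  int_R (fun u => int_R (F u)) = int_R (fun v => int_R (fun u => F u v)).
Proof.
  (* [W] compares the iterated improper integral with the integral over the square. It is used for
     [F] and for [F] with exchanged arguments, and [RInt_swap_order] joins the two. *)
  assert (W : forall F : R -> R -> R,
    (forall u v, continuity_2d_pt F u v) ->
    (forall u v, Rabs (F u v) <= C * lor u * lor v) ->
    (forall u, continuous (fun u => int_R (F u)) u) ->
    forall n, 1 <= n ->
    Rabs (int_R (fun u => int_R (F u)) - RInt (fun u => RInt (F u) (- n) n) (- n) n)
      <= 4 * C * PI / n).
  { clear F. intros F HF HC HA n Hn.
    assert (HC0 : 0 <= C).
    { assert (H := HC 0 0). assert (H0 := Rabs_pos (F 0 0)).
      unfold lor in H. replace (/ (1 + 0 ^ 2)) with 1 in H by (field; lra). lra. }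
    assert (HCu : forall u, dom (C * lor u) (F u)).
    { intros u. split; [|apply HC]. intros v. apply continuous_section, HF. }
    assert (HAd : dom (C * PI) (fun u => int_R (F u))).
    { split; [apply HA|]. intros u.
      replace (C * PI * lor u) with (C * lor u * PI) by ring.
      apply (int_R_bound (C * lor u)); [apply HCu|]. intros a b Hab.
      apply Rle_trans with (1 := dom_RInt _ _ _ _ (HCu u) Hab).
      apply Rmult_le_compat_l; [now apply dom_nonneg with (F u)|apply atan_diff_le]. }
    assert (HAn : forall u, continuous (fun u => RInt (F u) (- n) n) u)
      by (intros; now apply continuous_RInt_section).
    assert (H1 := int_R_approx _ _ n HAd ltac:(lra)).
    assert (H2 : Rabs (RInt (fun u => int_R (F u)) (- n) n
                   - RInt (fun u => RInt (F u) (- n) n) (- n) n) <= 2 * C / n * PI).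
    { rewrite <- (RInt_minus (fun u => int_R (F u))) by (apply ex_RInt_cont; auto).
      apply Rle_trans with (2 * C / n * (atan n - atan (- n))).
      - apply dom_RInt; [|lra]. split.
        + intros x. apply (continuous_minus (fun u => int_R (F u))); auto.
        + intros u. replace (2 * C / n * lor u) with (2 * (C * lor u) / n) by (field; lra).
          apply int_R_approx; [apply HCu|lra].
      - apply Rmult_le_compat_l; [|apply atan_diff_le].
        apply Rmult_le_pos; [lra|]. left. apply Rinv_0_lt_compat. lra. }
    apply Rabs_le_between in H1. apply Rabs_le_between in H2. apply Rabs_le_between.
    (* The outer tail costs [2 (C pi) / n]. The inner tails cost [2 C / n * lor u], whose integral
       is at most [2 C pi / n]. *)
    replace (4 * C * PI / n) with (2 * (C * PI) / n + 2 * C / n * PI) by (field; lra).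
    lra. }
  intros HF HC HA HB. apply (eq_of_le_div _ _ (8 * C * PI) 1). intros n Hn _.
  assert (H1 := W F HF HC HA n Hn).
  assert (H2 := W (fun v u => F u v) (fun v u => continuity_2d_pt_swap F u v (HF u v))
    (fun v u => ltac:(rewrite Rmult_assoc, (Rmult_comm (lor v)), <- Rmult_assoc; apply HC)) HB n Hn).
  rewrite (RInt_swap_order F) in H1 by assumption.
  apply Rabs_le_between in H1. apply Rabs_le_between in H2. apply Rabs_le_between.
  replace (8 * C * PI / n) with (4 * C * PI / n + 4 * C * PI / n) by (field; lra). lra.
Qed.

(** A quadratic Taylor remainder with majorant [lor] integrates to a quadratic remainder for the
    integral, which is all that differentiability needs. *)
Lemma is_derive_int_R (f : R -> R -> R) (g : R -> R) (w d K : R) : 0 < d ->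
  (forall w', Rabs (w' - w) < d -> exists C, dom C (f w')) -> (exists C, dom C g) ->
  (forall w' u, Rabs (w' - w) < d ->
    Rabs (f w' u - f w u - (w' - w) * g u) <= K * (w' - w) ^ 2 * lor u) ->
  is_derive (fun w => int_R (f w)) w (int_R g).
Proof.
  intros Hd Hf [Cg Hg] HK.
  destruct (Hf w) as [C Hw]; [rewrite Rminus_diag, Rabs_R0; assumption|].
  assert (HL := int_R_scal _ 1 _ dom_lor).
  set (L := int_R lor) in *.
  split; [apply is_linear_scal_l|].
  intros x Hx.
  assert (E0 : w = x) by exact (is_filter_lim_locally_unique (V := AbsRing_NormedModule R_AbsRing) w x Hx).
  subst x. clear Hx.
  intros [eps Heps].
  assert (HKL : 0 < Rabs K * Rabs L + 1)
    by (assert (h := Rabs_pos K); assert (h' := Rabs_pos L); nra).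
  assert (He : 0 < Rmin d (eps / (Rabs K * Rabs L + 1))).
  { apply Rmin_glb_lt; [assumption|]. now apply Rdiv_lt_0_compat. }
  exists (mkposreal _ He). intros w' Hw'. simpl in Hw'.
  change (Rabs (w' - w) < Rmin d (eps / (Rabs K * Rabs L + 1))) in Hw'.
  assert (H1 := Rlt_le_trans _ _ _ Hw' (Rmin_l _ _)).
  assert (H2 := Rlt_le_trans _ _ _ Hw' (Rmin_r _ _)).
  change (Rabs (int_R (f w') - int_R (f w) - (w' - w) * int_R g) <= eps * Rabs (w' - w)).
  destruct (Hf w' H1) as [C' Hw1].
  assert (E : int_R (fun u => (f w' u - f w u) - (w' - w) * g u)
    = int_R (f w') - int_R (f w) - (w' - w) * int_R g).
  { rewrite (int_R_minus (C' + Rabs (-1) * C) (Rabs (w' - w) * Cg) (fun u => f w' u - f w u)).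
    - rewrite (int_R_minus C' C) by assumption. now rewrite (int_R_scal Cg).
    - destruct (dom_plus _ _ _ _ Hw1 (dom_scal _ (-1) _ Hw)) as [h1 h2].
      split; intros x; [eapply continuous_ext; [|apply h1]|].
      + intros u; simpl; ring.
      + replace (f w' x - f w x) with (f w' x + -1 * f w x) by ring. apply h2.
    - now apply dom_scal. }
  assert (Hdm : dom (Rabs K * (w' - w) ^ 2) (fun u => (f w' u - f w u) - (w' - w) * g u)).
  { split.
    - intros x. apply (continuous_minus (fun u => f w' u - f w u)).
      + apply (continuous_minus (f w')); [apply Hw1|apply Hw].
      + apply (continuous_scal_r (w' - w) g), Hg.
    - intros u. apply Rle_trans with (1 := HK w' u H1).
      apply Rmult_le_compat_r; [left; apply lor_pos|].
      apply Rmult_le_compat_r; [apply pow2_ge_0|apply Rle_abs]. }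
  rewrite <- E.
  apply Rle_trans with (int_R (fun u => Rabs K * (w' - w) ^ 2 * lor u)).
  { eapply int_R_abs_le; [exact Hdm|apply dom_scal, dom_lor|apply Hdm]. }
  rewrite (int_R_scal 1) by apply dom_lor.
  change (int_R lor) with L.
  rewrite <- pow2_abs. simpl pow. rewrite Rmult_1_r.
  assert (h0 := Rabs_pos (w' - w)). set (h := Rabs (w' - w)) in *.
  assert (H3 : h * (Rabs K * Rabs L + 1) <= eps).
  { apply Rmult_lt_compat_r with (r := Rabs K * Rabs L + 1) in H2; [|assumption].
    replace (eps / (Rabs K * Rabs L + 1) * (Rabs K * Rabs L + 1)) with eps in H2 by (field; lra). lra. }
  assert (h3 := Rabs_pos K). assert (h4 := Rle_abs L).
  replace (Rabs K * (h * h) * L) with (h * (h * (Rabs K * L))) by ring.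
  rewrite (Rmult_comm eps). apply Rmult_le_compat_l; [assumption|].
  assert (Rabs K * L <= Rabs K * Rabs L) by now apply Rmult_le_compat_l.
  nra.
Qed.

(** * Decay of the densities *)

Lemma cosh_ge_1 (x : R) : 1 <= cosh x.
Proof.
  unfold cosh. assert (H1 := exp_ineq1_le x). assert (H2 := exp_ineq1_le (- x)). lra.
Qed.

Lemma cosh_sqr (x : R) : cosh x ^ 2 = 1 + sinh x ^ 2.
Proof.
  unfold cosh, sinh. assert (H : exp x * exp (- x) = 1) by (rewrite <- exp_plus, Rplus_opp_r; apply exp_0).
  nra.
Qed.

Lemma cosh_double (x : R) : cosh (2 * x) = 1 + 2 * sinh x ^ 2.
Proof.
  unfold cosh, sinh. assert (H : exp x * exp (- x) = 1) by (rewrite <- exp_plus, Rplus_opp_r; apply exp_0).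
  replace (2 * x) with (x + x) by ring. replace (- (x + x)) with (- x + - x) by ring.
  rewrite !exp_plus. nra.
Qed.

Lemma sinh_double (x : R) : sinh (2 * x) = 2 * sinh x * cosh x.
Proof.
  unfold cosh, sinh. replace (2 * x) with (x + x) by ring.
  replace (- (x + x)) with (- x + - x) by ring. rewrite !exp_plus. field.
Qed.

Lemma cosh_opp (x : R) : cosh (- x) = cosh x.
Proof. unfold cosh. rewrite Ropp_involutive. field. Qed.

Lemma sinh_opp (x : R) : sinh (- x) = - sinh x.
Proof. unfold sinh. rewrite Ropp_involutive. field. Qed.

Lemma is_derive_cosh (x : R) : is_derive cosh x (sinh x).
Proof. apply is_derive_Reals, derivable_pt_lim_cosh. Qed.

Lemma is_derive_sinh (x : R) : is_derive sinh x (cosh x).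
Proof. apply is_derive_Reals, derivable_pt_lim_sinh. Qed.

Lemma is_derive_continuity_pt (f : R -> R) (x d : R) : is_derive f x d -> continuity_pt f x.
Proof. intros H. apply continuity_pt_filterlim. now apply continuous_of_is_derive with d. Qed.

Lemma sinh_ge (x : R) : 0 <= x -> x <= sinh x.
Proof.
  intros Hx. destruct (MVT_gen sinh 0 x cosh) as (c & _ & Hc).
  - intros. apply is_derive_sinh.
  - intros. eapply is_derive_continuity_pt, is_derive_sinh.
  - rewrite sinh_0 in Hc. assert (H := cosh_ge_1 c). nra.
Qed.

Lemma sinh_sqr_ge (x : R) : x ^ 2 <= sinh x ^ 2.
Proof.
  destruct (Rle_dec 0 x) as [H|H].
  - apply sinh_ge in H as H'. nra.
  - assert (H' := sinh_ge (- x) ltac:(lra)). rewrite sinh_opp in H'. nra.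
Qed.

Lemma cosh_ge (x : R) : 1 + x ^ 2 / 2 <= cosh x.
Proof.
  replace x with (2 * (x / 2)) at 2 by field. rewrite cosh_double.
  assert (H := sinh_sqr_ge (x / 2)). lra.
Qed.

Lemma PI_gt_3 : 3 < PI.
Proof. assert (H := PI2_3_2). lra. Qed.

(** With [y = pi t / 2]: [cosh (2 y) = 2 cosh y ^ 2 - 1 >= cosh y ^ 2], and
    [cosh y >= 1 + pi^2 t^2 / 8 >= 1 + t^2] since [pi^2 >= 9]. The fourth power in [rho1_le] comes
    from here. *)
Lemma cosh_PI_ge (t : R) : (1 + t ^ 2) ^ 2 <= cosh (PI * t).
Proof.
  replace (PI * t) with (2 * (PI * t / 2)) by field.
  assert (H0 := cosh_double (PI * t / 2)). rewrite H0.
  assert (H1 := cosh_sqr (PI * t / 2)).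
  assert (H2 := cosh_ge (PI * t / 2)).
  assert (H3 : 1 + t ^ 2 <= cosh (PI * t / 2)).
  { apply Rle_trans with (2 := H2).
    assert (H := PI_gt_3). assert (9 <= PI ^ 2) by nra. assert (0 <= t ^ 2) by apply pow2_ge_0.
    replace ((PI * t / 2) ^ 2 / 2) with (PI ^ 2 * t ^ 2 / 8) by field. nra. }
  assert (0 <= t ^ 2) by apply pow2_ge_0. nra.
Qed.

Lemma rho1_pos (t : R) : 0 < rho1 t.
Proof.
  unfold rho1. assert (H := cosh_ge_1 (PI * t)). assert (H' := PI_RGT_0).
  apply Rmult_lt_0_compat; [lra|]. apply Rinv_0_lt_compat. nra.
Qed.

Lemma rho1_le (t : R) : rho1 t <= 2 * lor t ^ 4.
Proof.
  unfold rho1, lor. rewrite pow_inv.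
  assert (H := cosh_PI_ge t). assert (H' := PI_4). assert (H0 := PI_RGT_0).
  assert (H1 : 0 < (1 + t ^ 2) ^ 2) by (apply pow_lt; nra).
  assert (H2 : (1 + t ^ 2) ^ 4 <= cosh (PI * t) ^ 2)
    by (replace ((1 + t ^ 2) ^ 4) with (((1 + t ^ 2) ^ 2) ^ 2) by ring; apply pow_incr; lra).
  apply Rmult_le_compat; [lra| |lra|].
  - left. apply Rinv_0_lt_compat. apply pow_lt. lra.
  - apply Rinv_le_contravar; [apply pow_lt; nra|assumption].
Qed.

Lemma rho1_opp (t : R) : rho1 (- t) = rho1 t.
Proof. unfold rho1. rewrite Ropp_mult_distr_r_reverse, cosh_opp. reflexivity. Qed.

Lemma is_derive_rho1 (t : R) :
  is_derive rho1 t (- PI ^ 2 * sinh (PI * t) / cosh (PI * t) ^ 3).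
Proof.
  assert (H := cosh_ge_1 (PI * t)).
  unfold rho1. evar_last.
  - apply is_derive_scal, is_derive_inv; [|apply pow_nonzero; lra].
    apply is_derive_pow, (is_derive_comp cosh (fun x => PI * x)); [apply is_derive_cosh|].
    apply is_derive_scal, is_derive_id.
  - unfold scal, one; simpl. unfold mult; simpl. field. lra.
Qed.

Lemma continuous_rho1 (t : R) : continuous rho1 t.
Proof. eapply continuous_of_is_derive, is_derive_rho1. Qed.

(** [16] bounds [pi^2], and [|sinh| <= cosh] with [cosh >= 1] does the rest. A global Lipschitz
    constant passes to convolutions and makes them continuous. *)
Lemma rho1_lipschitz (s t : R) : Rabs (rho1 s - rho1 t) <= 16 * Rabs (s - t).
Proof.
  destruct (MVT_gen rho1 t s (fun t => - PI ^ 2 * sinh (PI * t) / cosh (PI * t) ^ 3))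
    as (c & _ & Hc).
  - intros. apply is_derive_rho1.
  - intros. eapply is_derive_continuity_pt, is_derive_rho1.
  - rewrite Hc, Rabs_mult. apply Rmult_le_compat_r; [apply Rabs_pos|].
    assert (H := cosh_ge_1 (PI * c)). assert (H1 := cosh_sqr (PI * c)).
    assert (H2 : Rabs (sinh (PI * c)) <= cosh (PI * c)) by (apply Rabs_le; nra).
    assert (H0 := PI_RGT_0). assert (H4 := PI_4).
    unfold Rdiv. rewrite !Rabs_mult, Rabs_Ropp, Rabs_inv.
    rewrite (Rabs_pos_eq (PI ^ 2)) by apply pow2_ge_0.
    rewrite (Rabs_pos_eq (cosh _ ^ 3)) by (apply pow_le; lra).
    apply Rmult_le_reg_r with (cosh (PI * c) ^ 3); [apply pow_lt; lra|].
    rewrite Rmult_assoc, Rinv_l, Rmult_1_r by (apply pow_nonzero; lra).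
    apply Rle_trans with (16 * cosh (PI * c)).
    + apply Rmult_le_compat; [apply pow2_ge_0|apply Rabs_pos|nra|assumption].
    + simpl. nra.
Qed.

Lemma continuous_of_lipschitz (f : R -> R) (K x : R) :
  (forall s t, Rabs (f s - f t) <= K * Rabs (s - t)) -> continuous f x.
Proof.
  intros H. apply (filterlim_locally f). intros [eps Heps].
  assert (HK : 0 < Rabs K + 1) by (assert (h := Rabs_pos K); lra).
  exists (mkposreal _ (Rdiv_lt_0_compat _ _ Heps HK)). intros t Ht.
  change (Rabs (t - x) < eps / (Rabs K + 1)) in Ht.
  change (Rabs (f t - f x) < eps).
  apply Rle_lt_trans with (1 := H t x).
  apply Rmult_lt_compat_r with (r := Rabs K + 1) in Ht; [|assumption].
  replace (eps / (Rabs K + 1) * (Rabs K + 1)) with eps in Ht by (field; lra).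
  assert (h := Rle_abs K). assert (h' := Rabs_pos (t - x)). nra.
Qed.

Lemma int_R_ge_0 (C : R) (f : R -> R) : dom C f -> (forall x, 0 <= f x) -> 0 <= int_R f.
Proof.
  intros Hd H. apply Rle_trans with (1 := Rabs_pos (int_R f)).
  apply int_R_abs_le with C C; [assumption|assumption|].
  intros x. rewrite Rabs_pos_eq; [apply Rle_refl|apply H].
Qed.

Lemma continuous_shift (f : R -> R) (u v : R) : (forall x, continuous f x) ->
  continuous (fun v => f (u - v)) v.
Proof.
  intros H. apply (continuous_comp (fun v => u - v) f); [|apply H].
  apply (continuous_minus (fun _ : R => u) (fun v : R => v)); [apply continuous_const|apply continuous_id].
Qed.

Lemma continuous_shift' (f : R -> R) (u v : R) : (forall x, continuous f x) ->
  continuous (fun u => f (u - v)) u.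
Proof.
  intros H. apply (continuous_comp (fun u => u - v) f); [|apply H].
  apply (continuous_minus (fun u : R => u) (fun _ : R => v)); [apply continuous_id|apply continuous_const].
Qed.

Lemma RInt_lor_shift_le (u a b : R) : RInt (fun v => lor (u - v)) a b <= PI.
Proof.
  replace (RInt (fun v => lor (u - v)) a b) with (- atan (u - b) - - atan (u - a)).
  - assert (H := atan_diff_le (u - b) (u - a)). lra.
  - symmetry. apply is_RInt_unique, (is_RInt_derive (fun v => - atan (u - v))).
    + intros v _. evar_last.
      * apply (is_derive_opp (fun v => atan (u - v))), (is_derive_comp atan (fun v => u - v)).
        -- apply is_derive_atan_lor.
        -- apply (is_derive_minus (fun _ => u) (fun v => v)); [apply is_derive_const|apply is_derive_id].
      * unfold opp, scal, minus, plus, zero, one, mult; simpl.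
        unfold mult, opp, plus; simpl. ring.
    + intros v _. apply continuous_shift, continuous_lor.
Qed.

(** The square of [lor] leaves room for a factor [1 + u^2]: functions of quadratic growth, among
    them [log |w + iu|] and [u^2], keep a Cauchy majorant after multiplication by such a density. *)
Record decaying (C : R) (r : R -> R) : Prop := {
  decaying_cont : forall x, continuous r x;
  decaying_even : forall x, r (- x) = r x;
  decaying_ge_0 : forall x, 0 <= r x;
  decaying_le : forall x, r x <= C * lor x ^ 2 }.

Lemma decaying_const_nonneg (C : R) (r : R -> R) : decaying C r -> 0 <= C.
Proof.
  intros H. assert (H1 := decaying_le _ _ H 0). assert (H2 := decaying_ge_0 _ _ H 0).
  unfold lor in H1. replace ((/ (1 + 0 ^ 2)) ^ 2) with 1 in H1 by (field; lra). lra.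
Qed.

Lemma lor_sqr_le (u : R) : lor u ^ 2 <= lor u.
Proof. assert (H := lor_pos u). assert (H1 := lor_le_1 u). nra. Qed.

Lemma rho1_le_lor_sqr (t : R) : rho1 t <= 2 * lor t ^ 2.
Proof.
  apply Rle_trans with (1 := rho1_le t). assert (H := lor_pos t). assert (H1 := lor_le_1 t).
  assert (H2 := lor_sqr_le t). assert (0 <= lor t ^ 2) by apply pow2_ge_0. nra.
Qed.

Lemma rho1_le_lor (t : R) : rho1 t <= 2 * lor t.
Proof. assert (H := rho1_le_lor_sqr t). assert (H2 := lor_sqr_le t). lra. Qed.

Lemma decaying_rho1 : decaying 2 rho1.
Proof.
  split; [apply continuous_rho1|apply rho1_opp|intros; left; apply rho1_pos|apply rho1_le_lor_sqr].
Qed.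

Lemma decaying_dom (C : R) (r : R -> R) : decaying C r -> dom C r.
Proof.
  intros H. split; [apply H|]. intros x.
  rewrite Rabs_pos_eq by apply H. apply Rle_trans with (1 := decaying_le _ _ H x).
  apply Rmult_le_compat_l; [now apply decaying_const_nonneg with r|apply lor_sqr_le].
Qed.

Lemma dom_conv (C u : R) (r : R -> R) : decaying C r -> dom (2 * C) (fun v => r v * rho1 (u - v)).
Proof.
  intros H. split.
  - intros v. apply (continuous_mult r (fun v => rho1 (u - v))); [apply H|].
    apply continuous_shift, continuous_rho1.
  - intros v. assert (H0 := rho1_pos (u - v)). assert (H1 := rho1_le_lor (u - v)).
    assert (H2 := lor_le_1 (u - v)). assert (H3 := proj2 (decaying_dom _ _ H) v).
    assert (H4 := decaying_ge_0 _ _ H v).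
    rewrite Rabs_pos_eq in * by nra.
    replace (2 * C * lor v) with (C * lor v * 2) by ring.
    apply Rmult_le_compat; lra.
Qed.

(* The surplus [lor t ^ 2] in the bound of [rho1] is what is left to integrate. *)
Lemma decaying_conv (C : R) (r : R -> R) : decaying C r ->
  decaying (8 * C * PI) (fun u => int_R (fun v => r v * rho1 (u - v))).
Proof.
  intros H. assert (HC := decaying_const_nonneg _ _ H). split.
  - intros x. apply continuous_of_lipschitz with (16 * int_R r). intros s t.
    rewrite <- (int_R_minus (2 * C) (2 * C)) by now apply dom_conv.
    replace (16 * int_R r * Rabs (s - t)) with (16 * Rabs (s - t) * int_R r) by ring.
    rewrite <- (int_R_scal C) by now apply decaying_dom.
    assert (D := dom_plus _ _ _ _ (dom_conv _ s _ H) (dom_scal _ (-1) _ (dom_conv _ t _ H))).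
    apply int_R_abs_le with (2 * C + Rabs (-1) * (2 * C)) (Rabs (16 * Rabs (s - t)) * C).
    + destruct D as [D1 D2]. split; intros v.
      * eapply continuous_ext; [|apply D1]. intros w; simpl; ring.
      * replace (_ - _) with (r v * rho1 (s - v) + -1 * (r v * rho1 (t - v))) by ring. apply D2.
    + apply dom_scal. now apply decaying_dom.
    + intros v. replace (_ - _) with (r v * (rho1 (s - v) - rho1 (t - v))) by ring.
      rewrite Rabs_mult, Rmult_comm, (Rabs_pos_eq (r v)) by apply H.
      apply Rmult_le_compat_r; [apply H|].
      apply Rle_trans with (1 := rho1_lipschitz _ _).
      right. f_equal. f_equal. ring.
  - intros u. rewrite <- (int_R_opp (2 * C)) by now apply dom_conv.
    apply int_R_ext. intros v. rewrite (decaying_even _ _ H), <- rho1_opp. f_equal. f_equal. ring.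
  - intros u. apply int_R_ge_0 with (2 * C); [now apply dom_conv|].
    intros v. apply Rmult_le_pos; [apply H|left; apply rho1_pos].
  - intros u. apply Rle_trans with (1 := Rle_abs _).
    apply int_R_bound with (2 * C); [now apply dom_conv|]. intros a b Hab.
    assert (Hc : forall x, continuous (fun v => r v * rho1 (u - v)) x) by apply (dom_conv _ u _ H).
    assert (Hl : forall x, continuous (fun v => 8 * C * lor u ^ 2 * lor (u - v)) x).
    { intros x. apply (continuous_scal_r (8 * C * lor u ^ 2) (fun v => lor (u - v))).
      apply continuous_shift, continuous_lor. }
    rewrite Rabs_pos_eq.
    2:{ apply RInt_ge_0; [assumption|now apply ex_RInt_cont|].
        intros v _. apply Rmult_le_pos; [apply H|left; apply rho1_pos]. }
    apply Rle_trans with (RInt (fun v => 8 * C * lor u ^ 2 * lor (u - v)) a b).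
    + apply RInt_le; [assumption|now apply ex_RInt_cont|now apply ex_RInt_cont|].
      intros v _.
      assert (H1 := lor_mul_le v (u - v)). replace (v + (u - v)) with u in H1 by ring.
      assert (H2 := rho1_le (u - v)). assert (H3 := decaying_le _ _ H v).
      assert (p1 := lor_pos v). assert (p2 := lor_pos (u - v)). assert (p3 := lor_pos u).
      assert (H4 : (lor v * lor (u - v)) ^ 2 <= 4 * lor u ^ 2)
        by (replace (4 * lor u ^ 2) with ((2 * lor u) ^ 2) by ring; apply pow_incr; nra).
      apply Rle_trans with ((C * lor v ^ 2) * (2 * lor (u - v) ^ 4)).
      * apply Rmult_le_compat; [apply H|left; apply rho1_pos|assumption|assumption].
      * replace (C * lor v ^ 2 * (2 * lor (u - v) ^ 4))
          with (2 * C * ((lor v * lor (u - v)) ^ 2 * lor (u - v) ^ 2)) by ring.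
        replace (8 * C * lor u ^ 2 * lor (u - v))
          with (2 * C * (4 * lor u ^ 2 * lor (u - v))) by ring.
        apply Rmult_le_compat_l; [lra|].
        apply Rmult_le_compat; [apply pow2_ge_0|apply pow2_ge_0|assumption|apply lor_sqr_le].
    + rewrite (RInt_scal (fun v => lor (u - v)))
        by (apply ex_RInt_cont; intros; apply continuous_shift, continuous_lor).
      change (8 * C * lor u ^ 2 * RInt (fun v => lor (u - v)) a b <= 8 * C * PI * lor u ^ 2).
      replace (8 * C * PI * lor u ^ 2) with (8 * C * lor u ^ 2 * PI) by ring.
      apply Rmult_le_compat_l; [|apply RInt_lor_shift_le].
      apply Rmult_le_pos; [lra|apply pow2_ge_0].
Qed.

Lemma rho_aux_decaying (n : nat) : exists C, decaying C (rho_aux n).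
Proof.
  induction n as [|n [C IH]]; simpl.
  - exists 2. apply decaying_rho1.
  - exists (8 * C * PI). now apply decaying_conv.
Qed.

(** * Logistic averages of a unit difference of [log |w + iu|] *)

(* [1 / (w + iu) = pw w u - i qw w u]; [dpw] and [epw] are the partial derivatives of [pw]. *)
Definition pw (w u : R) : R := w / (w ^ 2 + u ^ 2).
Definition qw (w u : R) : R := u / (w ^ 2 + u ^ 2).
Definition dpw (w u : R) : R := (u ^ 2 - w ^ 2) / (w ^ 2 + u ^ 2) ^ 2.
Definition epw (w u : R) : R := - (2 * w * u) / (w ^ 2 + u ^ 2) ^ 2.

Lemma sum_sqr_pos (w u : R) : w <> 0 -> 0 < w ^ 2 + u ^ 2.
Proof. intros H. assert (0 < w ^ 2) by now apply pow2_gt_0. nra. Qed.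

Lemma is_derive_pw_l (w u : R) : w <> 0 -> is_derive (fun w => pw w u) w (dpw w u).
Proof.
  intros H. apply (sum_sqr_pos w u) in H. unfold pw, dpw.
  auto_derive; [lra | field; lra].
Qed.

Lemma is_derive_pw_r (w u : R) : w <> 0 -> is_derive (fun u => pw w u) u (epw w u).
Proof.
  intros H. apply (sum_sqr_pos w u) in H. unfold pw, epw.
  auto_derive; [lra | field; lra].
Qed.

Lemma is_derive_qw_l (w u : R) : w <> 0 -> is_derive (fun w => qw w u) w (epw w u).
Proof.
  intros H. apply (sum_sqr_pos w u) in H. unfold qw, epw.
  auto_derive; [lra | field; lra].
Qed.

Lemma is_derive_qw_r (w u : R) : w <> 0 -> is_derive (fun u => qw w u) u (- dpw w u).
Proof.
  intros H. apply (sum_sqr_pos w u) in H. unfold qw, dpw.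
  auto_derive; [lra | field; lra].
Qed.

Lemma Rabs_div_le (x y B : R) : 0 < y -> Rabs x <= B * y -> Rabs (x / y) <= B.
Proof.
  intros Hy H. unfold Rdiv. rewrite Rabs_mult, Rabs_inv, (Rabs_pos_eq y) by lra.
  apply Rmult_le_reg_r with y; [assumption|]. rewrite Rmult_assoc, Rinv_l by lra. lra.
Qed.

Lemma dpw_bound (m w u : R) : 0 < m -> m <= w -> Rabs (dpw w u) <= / m ^ 2.
Proof.
  intros Hm Hw. assert (H := sum_sqr_pos w u ltac:(lra)).
  assert (Hm2 : 0 < m ^ 2) by (apply pow_lt; lra).
  assert (m ^ 2 <= w ^ 2 + u ^ 2) by nra.
  apply Rabs_div_le; [now apply pow_lt|].
  apply Rle_trans with (w ^ 2 + u ^ 2); [apply Rabs_le; nra|].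
  apply Rmult_le_reg_l with (m ^ 2); [assumption|].
  rewrite <- Rmult_assoc, Rinv_r, Rmult_1_l by lra. simpl (_ ^ 2) at 5. nra.
Qed.

Lemma epw_bound (m w u : R) : 0 < m -> m <= w -> Rabs (epw w u) <= / m ^ 2.
Proof.
  intros Hm Hw. assert (H := sum_sqr_pos w u ltac:(lra)).
  assert (Hm2 : 0 < m ^ 2) by (apply pow_lt; lra).
  assert (m ^ 2 <= w ^ 2 + u ^ 2) by nra.
  apply Rabs_div_le; [now apply pow_lt|].
  apply Rle_trans with (w ^ 2 + u ^ 2).
  - assert (h := pow2_ge_0 (w - u)). assert (h' := pow2_ge_0 (w + u)). apply Rabs_le. lra.
  - apply Rmult_le_reg_l with (m ^ 2); [assumption|].
    rewrite <- Rmult_assoc, Rinv_r, Rmult_1_l by lra. nra.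
Qed.

Lemma pw_le_inv (w u : R) : 0 < w -> u <> 0 -> Rabs (pw w u) <= / Rabs u.
Proof.
  intros Hw Hu. assert (H := sum_sqr_pos w u ltac:(lra)).
  assert (Ha := Rabs_pos_lt u Hu).
  apply Rabs_div_le; [assumption|]. rewrite Rabs_pos_eq by lra.
  apply Rmult_le_reg_l with (Rabs u); [assumption|].
  rewrite <- Rmult_assoc, Rinv_r, Rmult_1_l by lra. rewrite <- (pow2_abs u). nra.
Qed.

Lemma qw_le_inv (w u : R) : 0 < w -> u <> 0 -> Rabs (qw w u) <= / Rabs u.
Proof.
  intros Hw Hu. assert (H := sum_sqr_pos w u ltac:(lra)).
  assert (Ha := Rabs_pos_lt u Hu).
  apply Rabs_div_le; [assumption|].
  apply Rmult_le_reg_l with (Rabs u); [assumption|].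
  rewrite <- Rmult_assoc, Rinv_r, Rmult_1_l by lra. rewrite <- (pow2_abs u). nra.
Qed.

(* [coth (pi (t - i a)) = kX a t + i kZ a t]. *)
Definition kQ (a t : R) : R := cosh (2 * PI * t) - cos (2 * PI * a).
Definition kX (a t : R) : R := sinh (2 * PI * t) / kQ a t.
Definition kZ (a t : R) : R := sin (2 * PI * a) / kQ a t.
Definition dkX (a t : R) : R := - (2 * PI * sinh (2 * PI * t) * sin (2 * PI * a)) / kQ a t ^ 2.
Definition ekX (a t : R) : R := 2 * PI * (1 - cosh (2 * PI * t) * cos (2 * PI * a)) / kQ a t ^ 2.

(** This is [2 |sinh (pi (t - i a))|^2], so the kernel is singular only where [t = 0] and [a] is an
    integer. *)
Lemma kQ_eq (a t : R) : kQ a t = 2 * (sinh (PI * t) ^ 2 + sin (PI * a) ^ 2).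
Proof.
  unfold kQ. rewrite !Rmult_assoc, cosh_double, cos_2a_sin. ring.
Qed.

Lemma kQ_pos (a t : R) : 0 < a < 1 -> 0 < kQ a t.
Proof.
  intros Ha. rewrite kQ_eq. assert (H := pow2_ge_0 (sinh (PI * t))).
  assert (H0 := PI_RGT_0).
  assert (0 < sin (PI * a)) by (apply sin_gt_0; nra).
  assert (0 < sin (PI * a) ^ 2) by (apply pow_lt; lra). lra.
Qed.

Lemma is_derive_sin (x : R) : is_derive sin x (cos x).
Proof. apply is_derive_Reals, derivable_pt_lim_sin. Qed.

Lemma is_derive_cos (x : R) : is_derive cos x (- sin x).
Proof. apply is_derive_Reals, derivable_pt_lim_cos. Qed.

Lemma is_derive_scaled (f : R -> R) (k x d : R) : is_derive f (k * x) d ->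
  is_derive (fun x => f (k * x)) x (k * d).
Proof.
  intros H. evar_last.
  - apply (is_derive_comp f (fun x => k * x)); [exact H|].
    apply (is_derive_scal (fun x => x)), is_derive_id.
  - unfold scal, one; simpl. unfold mult; simpl. ring.
Qed.

Lemma is_derive_kQ_l (a t : R) : is_derive (fun a => kQ a t) a (2 * PI * sin (2 * PI * a)).
Proof.
  unfold kQ. evar_last.
  - apply (is_derive_minus (fun _ => cosh (2 * PI * t)) (fun a => cos (2 * PI * a)));
      [apply is_derive_const|apply is_derive_scaled, is_derive_cos].
  - unfold minus, plus, opp, zero; simpl. ring.
Qed.

Lemma is_derive_kQ_r (a t : R) : is_derive (fun t => kQ a t) t (2 * PI * sinh (2 * PI * t)).
Proof.
  unfold kQ. evar_last.
  - apply (is_derive_minus (fun t => cosh (2 * PI * t)) (fun _ => cos (2 * PI * a)));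
      [apply is_derive_scaled, is_derive_cosh|apply is_derive_const].
  - unfold minus, plus, opp, zero; simpl. ring.
Qed.

Lemma is_derive_kX_l (a t : R) : 0 < a < 1 -> is_derive (fun a => kX a t) a (dkX a t).
Proof.
  intros Ha. assert (H := kQ_pos a t Ha). unfold kX. evar_last.
  - apply (is_derive_div (fun _ => sinh (2 * PI * t)));
      [apply is_derive_const|apply is_derive_kQ_l|lra].
  - unfold dkX, zero; simpl. field. lra.
Qed.

Lemma is_derive_kX_r (a t : R) : 0 < a < 1 -> is_derive (fun t => kX a t) t (ekX a t).
Proof.
  intros Ha. assert (H := kQ_pos a t Ha). unfold kX. evar_last.
  - apply (is_derive_div (fun t => sinh (2 * PI * t)));
      [apply is_derive_scaled, is_derive_sinh|apply is_derive_kQ_r|lra].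
  - unfold ekX. assert (E := cosh_sqr (2 * PI * t)).
    unfold Rdiv. f_equal. unfold kQ.
    transitivity (2 * PI * (cosh (2 * PI * t) ^ 2 - sinh (2 * PI * t) ^ 2
      - cosh (2 * PI * t) * cos (2 * PI * a))); [ring|rewrite E; ring].
Qed.

Lemma is_derive_kZ_l (a t : R) : 0 < a < 1 -> is_derive (fun a => kZ a t) a (- ekX a t).
Proof.
  intros Ha. assert (H := kQ_pos a t Ha). unfold kZ. evar_last.
  - apply (is_derive_div (fun a => sin (2 * PI * a)));
      [apply is_derive_scaled, is_derive_sin|apply is_derive_kQ_l|lra].
  - unfold ekX. assert (E := sin2_cos2 (2 * PI * a)). unfold Rsqr in E.
    unfold Rdiv. rewrite <- Ropp_mult_distr_l_reverse. f_equal. unfold kQ.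
    transitivity (2 * PI * (cosh (2 * PI * t) * cos (2 * PI * a)
      - (sin (2 * PI * a) * sin (2 * PI * a) + cos (2 * PI * a) * cos (2 * PI * a))));
      [ring|rewrite E; ring].
Qed.

Lemma is_derive_kZ_r (a t : R) : 0 < a < 1 -> is_derive (fun t => kZ a t) t (dkX a t).
Proof.
  intros Ha. assert (H := kQ_pos a t Ha). unfold kZ. evar_last.
  - apply (is_derive_div (fun _ => sin (2 * PI * a)));
      [apply is_derive_const|apply is_derive_kQ_r|lra].
  - unfold dkX, zero; simpl. field. lra.
Qed.

Lemma is_derive_shift (f : R -> R) (u v d : R) : is_derive f (u - v) d ->
  is_derive (fun u => f (u - v)) u d.
Proof.
  intros H. evar_last.
  - apply (is_derive_comp f (fun u => u - v)); [exact H|].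
    apply (is_derive_minus (fun u => u) (fun _ => v)); [apply is_derive_id|apply is_derive_const].
  - unfold scal, minus, plus, opp, zero, one; simpl. unfold mult; simpl. ring.
Qed.

(* With [Phi(a) = coth(pi (t - i a)) / (w + a + i u)], [t = u - v], holomorphic in [a + i u]:
   [flow] is [Im (Phi(a) - Phi(-a))], [flux] is [- Re (Phi(a) + Phi(-a))], and Cauchy-Riemann gives
   [d flow / d a = d flux / d u = dflow]. *)
Definition flow (w v a u : R) : R :=
  kZ a (u - v) * (pw (w + a) u + pw (w - a) u) - kX a (u - v) * (qw (w + a) u - qw (w - a) u).
Definition flux (w v a u : R) : R :=
  - kX a (u - v) * (pw (w + a) u + pw (w - a) u) - kZ a (u - v) * (qw (w + a) u - qw (w - a) u).
Definition dflow (w v a u : R) : R :=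
  - ekX a (u - v) * (pw (w + a) u + pw (w - a) u) + kZ a (u - v) * (dpw (w + a) u - dpw (w - a) u)
  - dkX a (u - v) * (qw (w + a) u - qw (w - a) u) - kX a (u - v) * (epw (w + a) u + epw (w - a) u).

Lemma is_derive_add_l (f : R -> R) (w a d : R) : is_derive f (w + a) d ->
  is_derive (fun a => f (w + a)) a d.
Proof.
  intros H. evar_last.
  - apply (is_derive_comp f (fun a => w + a)); [exact H|].
    apply (is_derive_plus (fun _ => w) (fun a => a)); [apply is_derive_const|apply is_derive_id].
  - unfold scal, plus, zero, one; simpl. unfold mult; simpl. ring.
Qed.

Lemma is_derive_sub_l (f : R -> R) (w a d : R) : is_derive f (w - a) d ->
  is_derive (fun a => f (w - a)) a (- d).
Proof.
  intros H. evar_last.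
  - apply (is_derive_comp f (fun a => w - a)); [exact H|].
    apply (is_derive_minus (fun _ => w) (fun a => a)); [apply is_derive_const|apply is_derive_id].
  - unfold scal, minus, plus, opp, zero, one; simpl. unfold mult; simpl. ring.
Qed.

Lemma is_derive_Rmult (f g : R -> R) (x df dg : R) : is_derive f x df -> is_derive g x dg ->
  is_derive (fun x => f x * g x) x (df * g x + f x * dg).
Proof. intros Hf Hg. apply (is_derive_mult f g); auto. intros; apply Rmult_comm. Qed.

Lemma is_derive_Rplus (f g : R -> R) (x df dg : R) : is_derive f x df -> is_derive g x dg ->
  is_derive (fun x => f x + g x) x (df + dg).
Proof. apply (is_derive_plus f g). Qed.

Lemma is_derive_Rminus (f g : R -> R) (x df dg : R) : is_derive f x df -> is_derive g x dg ->
  is_derive (fun x => f x - g x) x (df - dg).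
Proof. apply (is_derive_minus f g). Qed.

Lemma is_derive_Ropp (f : R -> R) (x df : R) : is_derive f x df ->
  is_derive (fun x => - f x) x (- df).
Proof. apply (is_derive_opp f). Qed.

Lemma is_derive_flow (w v a u : R) : 0 < a < 1 -> a < w ->
  is_derive (fun a => flow w v a u) a (dflow w v a u).
Proof.
  intros Ha Hw. unfold flow. evar_last.
  - apply (is_derive_Rminus (fun a => kZ a (u - v) * (pw (w + a) u + pw (w - a) u))
      (fun a => kX a (u - v) * (qw (w + a) u - qw (w - a) u))).
    + apply (is_derive_Rmult (fun a => kZ a (u - v))); [now apply is_derive_kZ_l|].
      apply (is_derive_Rplus (fun a => pw (w + a) u)).
      * apply (is_derive_add_l (fun w => pw w u)), is_derive_pw_l; lra.
      * apply (is_derive_sub_l (fun w => pw w u)), is_derive_pw_l; lra.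
    + apply (is_derive_Rmult (fun a => kX a (u - v))); [now apply is_derive_kX_l|].
      apply (is_derive_Rminus (fun a => qw (w + a) u)).
      * apply (is_derive_add_l (fun w => qw w u)), is_derive_qw_l; lra.
      * apply (is_derive_sub_l (fun w => qw w u)), is_derive_qw_l; lra.
  - unfold dflow. ring.
Qed.

Lemma is_derive_flux (w v a u : R) : 0 < a < 1 -> a < w ->
  is_derive (fun u => flux w v a u) u (dflow w v a u).
Proof.
  intros Ha Hw. unfold flux. evar_last.
  - apply (is_derive_Rminus (fun u => - kX a (u - v) * (pw (w + a) u + pw (w - a) u))
      (fun u => kZ a (u - v) * (qw (w + a) u - qw (w - a) u))).
    + apply (is_derive_Rmult (fun u => - kX a (u - v))).
      * apply is_derive_Ropp, (is_derive_shift (kX a)). now apply is_derive_kX_r.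
      * apply (is_derive_Rplus (fun u => pw (w + a) u)); apply is_derive_pw_r; lra.
    + apply (is_derive_Rmult (fun u => kZ a (u - v))).
      * apply (is_derive_shift (kZ a)). now apply is_derive_kZ_r.
      * apply (is_derive_Rminus (fun u => qw (w + a) u)); apply is_derive_qw_r; lra.
  - unfold dflow. ring.
Qed.

Lemma continuity_2d_pt_div (f g : R -> R -> R) (x t : R) :
  continuity_2d_pt f x t -> continuity_2d_pt g x t -> g x t <> 0 ->
  continuity_2d_pt (fun a u => f a u / g a u) x t.
Proof. intros. apply continuity_2d_pt_mult; [assumption|now apply continuity_2d_pt_inv]. Qed.

Ltac c2d := repeat first
  [ assumption
  | apply continuity_2d_pt_const
  | apply continuity_2d_pt_id1
  | apply continuity_2d_pt_id2
  | apply continuity_2d_pt_div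
  | apply continuity_2d_pt_plus
  | apply continuity_2d_pt_minus
  | apply continuity_2d_pt_opp
  | apply continuity_2d_pt_mult ].

Lemma continuity_2d_dflow (w v a u : R) : 0 < a < 1 -> a < w ->
  continuity_2d_pt (dflow w v) a u.
Proof.
  intros Ha Hw.
  assert (HQ := kQ_pos a (u - v) Ha). assert (HQ2 := pow_lt _ 2 HQ).
  assert (H1 := sum_sqr_pos (w + a) u ltac:(lra)). assert (H2 := sum_sqr_pos (w - a) u ltac:(lra)).
  assert (H1' := pow_lt _ 2 H1). assert (H2' := pow_lt _ 2 H2).
  assert (Csin : continuity_2d_pt (fun a _ => sin (2 * PI * a)) a u).
  { apply (continuity_2d_pt_fst (fun a => sin (2 * PI * a))).
    eapply continuous_of_is_derive, is_derive_scaled, is_derive_sin. }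
  assert (Ccos : continuity_2d_pt (fun a _ => cos (2 * PI * a)) a u).
  { apply (continuity_2d_pt_fst (fun a => cos (2 * PI * a))).
    eapply continuous_of_is_derive, is_derive_scaled, is_derive_cos. }
  assert (Csinh : continuity_2d_pt (fun _ u => sinh (2 * PI * (u - v))) a u).
  { apply (continuity_2d_pt_snd (fun u => sinh (2 * PI * (u - v)))).
    eapply continuous_of_is_derive, (is_derive_shift (fun t => sinh (2 * PI * t))), is_derive_scaled,
      is_derive_sinh. }
  assert (Ccosh : continuity_2d_pt (fun _ u => cosh (2 * PI * (u - v))) a u).
  { apply (continuity_2d_pt_snd (fun u => cosh (2 * PI * (u - v)))).
    eapply continuous_of_is_derive, (is_derive_shift (fun t => cosh (2 * PI * t))), is_derive_scaled,
      is_derive_cosh. }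
  assert (CQ : continuity_2d_pt (fun a u => kQ a (u - v)) a u)
    by (apply continuity_2d_pt_minus; assumption).
  assert (Csq : forall f, continuity_2d_pt f a u -> continuity_2d_pt (fun x y => f x y ^ 2) a u)
    by (intros f Hf; simpl; c2d).
  unfold dflow, kX, kZ, ekX, dkX, pw, qw, dpw, epw.
  repeat (first [apply Csq | progress c2d]); apply Rgt_not_eq; assumption.
Qed.

Lemma continuous_flow (w v a u : R) : 0 < a < 1 -> a < w -> continuous (flow w v a) u.
Proof.
  intros Ha Hw. eapply continuous_of_is_derive. unfold flow.
  apply (is_derive_Rminus (fun u => kZ a (u - v) * (pw (w + a) u + pw (w - a) u))
      (fun u => kX a (u - v) * (qw (w + a) u - qw (w - a) u))).
  - apply (is_derive_Rmult (fun u => kZ a (u - v))).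
    + apply (is_derive_shift (kZ a)). now apply is_derive_kZ_r.
    + apply (is_derive_Rplus (fun u => pw (w + a) u)); apply is_derive_pw_r; lra.
  - apply (is_derive_Rmult (fun u => kX a (u - v))).
    + apply (is_derive_shift (kX a)). now apply is_derive_kX_r.
    + apply (is_derive_Rminus (fun u => qw (w + a) u)); apply is_derive_qw_r; lra.
Qed.

(** Cauchy's theorem between neighbouring lines: the [a]-derivative of the integrand is also a
    [u]-derivative, so only the values of [flux] at the two ends remain. *)
Lemma is_derive_RInt_flow (w v n a : R) : 0 < a < 1 -> a < w ->
  is_derive (fun a => RInt (flow w v a) (- n) n) a (flux w v a n - flux w v a (- n)).
Proof.
  intros Ha Hw.
  assert (Hr : 0 < Rmin a (Rmin (1 - a) (w - a))) by (repeat apply Rmin_glb_lt; lra).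
  assert (Hloc : locally a (fun b => 0 < b < 1 /\ b < w)).
  { exists (mkposreal _ Hr). intros b Hb.
    assert (h1 := Rmin_l a (Rmin (1 - a) (w - a))). assert (h2 := Rmin_r a (Rmin (1 - a) (w - a))).
    assert (h3 := Rmin_l (1 - a) (w - a)). assert (h4 := Rmin_r (1 - a) (w - a)).
    change (Rabs (b - a) < Rmin a (Rmin (1 - a) (w - a))) in Hb.
    apply Rabs_lt_between in Hb. lra. }
  assert (E : RInt (fun u => Derive (fun a => flow w v a u) a) (- n) n
              = flux w v a n - flux w v a (- n)).
  { rewrite (RInt_ext _ (dflow w v a)).
    - apply is_RInt_unique, (is_RInt_derive (flux w v a)).
      + intros u _. now apply is_derive_flux.
      + intros u _. now apply continuous_section, continuity_2d_dflow.
    - intros u _. apply is_derive_unique. now apply is_derive_flow. }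
  rewrite <- E. apply (is_derive_RInt_param (flow w v)).
  - apply filter_imp with (2 := Hloc). intros b [Hb1 Hb2] u _.
    eexists. now apply is_derive_flow.
  - intros u _. apply continuity_2d_pt_ext_loc with (dflow w v).
    + destruct Hloc as [e He]. exists e. intros b s Hb _.
      symmetry. apply is_derive_unique. now apply is_derive_flow; apply He.
    + now apply continuity_2d_dflow.
  - apply filter_imp with (2 := Hloc). intros b [Hb1 Hb2].
    apply ex_RInt_cont. intros u. now apply continuous_flow.
Qed.

(** * Decay of the flux at the ends, and the displacement of the lines *)

Lemma kQ_ge (a t : R) : 1 <= Rabs t -> 18 <= kQ a t.
Proof.
  intros Ht. rewrite kQ_eq. assert (H := sinh_sqr_ge (PI * t)).
  assert (H' := pow2_ge_0 (sin (PI * a))). assert (H0 := PI_gt_3).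
  assert (1 <= t ^ 2) by (rewrite <- pow2_abs; nra).
  assert (9 <= PI ^ 2) by nra.
  assert (9 <= (PI * t) ^ 2) by (rewrite Rpow_mult_distr; nra). lra.
Qed.

Lemma kZ_bound (a t : R) : 1 <= Rabs t -> Rabs (kZ a t) <= 1.
Proof.
  intros Ht. assert (H := kQ_ge a t Ht). apply Rabs_div_le; [lra|].
  assert (H1 := SIN_bound (2 * PI * a)). apply Rabs_le. lra.
Qed.

Lemma kX_bound (a t : R) : 1 <= Rabs t -> Rabs (kX a t) <= 2.
Proof.
  intros Ht. assert (H := kQ_ge a t Ht). apply Rabs_div_le; [lra|].
  assert (H1 := COS_bound (2 * PI * a)). unfold kQ in *.
  assert (H2 := cosh_sqr (2 * PI * t)). assert (H3 := cosh_ge_1 (2 * PI * t)).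
  apply Rle_trans with (cosh (2 * PI * t)); [|lra].
  apply Rabs_le. nra.
Qed.

(** Away from the pole the kernel is bounded, and the reciprocals of [w + a + iu] and [w - a + iu]
    supply the decay: [6 = 2 * 2 + 1 * 2]. *)
Lemma flux_bound (w v a u : R) : 0 <= a -> a < w -> 1 <= Rabs (u - v) -> u <> 0 ->
  Rabs (flux w v a u) <= 6 / Rabs u.
Proof.
  intros Ha Hw Ht Hu. unfold flux.
  assert (H1 := kX_bound a _ Ht). assert (H2 := kZ_bound a _ Ht).
  assert (H3 := pw_le_inv (w + a) u ltac:(lra) Hu). assert (H4 := pw_le_inv (w - a) u ltac:(lra) Hu).
  assert (H5 := qw_le_inv (w + a) u ltac:(lra) Hu). assert (H6 := qw_le_inv (w - a) u ltac:(lra) Hu).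
  set (d := / Rabs u) in *.
  assert (H7 : Rabs (pw (w + a) u + pw (w - a) u) <= 2 * d)
    by (apply Rle_trans with (1 := Rabs_triang _ _); lra).
  assert (H8 : Rabs (qw (w + a) u - qw (w - a) u) <= 2 * d)
    by (apply Rle_trans with (1 := Rabs_triang _ _); rewrite Rabs_Ropp; lra).
  apply Rle_trans with (1 := Rabs_triang _ _). rewrite Rabs_Ropp, !Rabs_mult, Rabs_Ropp.
  unfold Rdiv. fold d. replace (6 * d) with (2 * (2 * d) + 1 * (2 * d)) by ring.
  apply Rplus_le_compat; apply Rmult_le_compat; auto using Rabs_pos.
Qed.

(** The two ends contribute at most [12 / n], over a path of length at most [1 / 2]. The bound does
    not depend on [a], so [a] may tend to 0 while [n] is fixed. *)
Lemma flow_half_approx (w v n a : R) : 1 / 2 < w -> Rabs v + 1 <= n -> 0 < a <= 1 / 2 ->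
  Rabs (RInt (flow w v (1 / 2)) (- n) n - RInt (flow w v a) (- n) n) <= 6 / n.
Proof.
  intros Hw Hn Ha.
  assert (Hv := Rabs_pos v). assert (Hv1 := Rle_abs v). assert (Hv2 := Rle_abs (- v)).
  rewrite Rabs_Ropp in Hv2.
  assert (Hn1 : 1 <= Rabs (n - v)) by (rewrite Rabs_pos_eq; lra).
  assert (Hn2 : 1 <= Rabs (- n - v)) by (rewrite Rabs_left; lra).
  destruct (MVT_gen (fun a => RInt (flow w v a) (- n) n) a (1 / 2)
    (fun a => flux w v a n - flux w v a (- n))) as (c & Hc & E).
  - rewrite Rmin_left, Rmax_right by lra. intros x Hx. apply is_derive_RInt_flow; lra.
  - rewrite Rmin_left, Rmax_right by lra. intros x Hx.
    eapply is_derive_continuity_pt, is_derive_RInt_flow; lra.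
  - rewrite Rmin_left, Rmax_right in Hc by lra. rewrite E.
    assert (H1 := flux_bound w v c n ltac:(lra) ltac:(lra) Hn1 ltac:(lra)).
    assert (H2 := flux_bound w v c (- n) ltac:(lra) ltac:(lra) Hn2 ltac:(lra)).
    rewrite Rabs_Ropp in H2. rewrite (Rabs_pos_eq n) in H1, H2 by lra.
    rewrite Rabs_mult, (Rabs_pos_eq (1 / 2 - a)) by lra.
    assert (H3 : Rabs (flux w v c n - flux w v c (- n)) <= 12 / n).
    { apply Rle_trans with (1 := Rabs_triang _ _). rewrite Rabs_Ropp.
      replace (12 / n) with (6 / n + 6 / n) by (field; lra). lra. }
    replace (6 / n) with (12 / n * (1 / 2)) by (field; lra).
    apply Rmult_le_compat; [apply Rabs_pos|lra|assumption|lra].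
Qed.

(** * The limit [a -> 0]: concentration of the kernel at [u = v] *)

Lemma sin_PI_ge (a : R) : 0 <= a <= 1 / 4 -> a <= sin (PI * a).
Proof.
  intros Ha. assert (H0 := PI_gt_3). assert (H4 := PI_4).
  destruct (MVT_gen sin 0 (PI * a) cos) as (c & Hc & E).
  - intros. apply is_derive_sin.
  - intros. eapply is_derive_continuity_pt, is_derive_sin.
  - rewrite Rmin_left, Rmax_right in Hc by nra. rewrite sin_0 in E.
    assert (1 / 2 <= cos c).
    { rewrite <- cos_PI3. apply cos_decr_1; nra. }
    nra.
Qed.

Lemma kQ_lower (a t : R) : 0 <= a <= 1 / 4 -> 2 * (a ^ 2 + t ^ 2) <= kQ a t.
Proof.
  intros Ha. rewrite kQ_eq. assert (H := sinh_sqr_ge (PI * t)).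
  assert (H' := sin_PI_ge a Ha). assert (H0 := PI_gt_3).
  assert (0 <= t ^ 2) by apply pow2_ge_0. assert (9 <= PI ^ 2) by nra.
  assert (t ^ 2 <= (PI * t) ^ 2) by (rewrite Rpow_mult_distr; nra).
  assert (a ^ 2 <= sin (PI * a) ^ 2) by (apply pow_incr; lra). lra.
Qed.

Lemma exp_mono (x y : R) : x <= y -> exp x <= exp y.
Proof. intros [H| ->]; [left; now apply exp_increasing|apply Rle_refl]. Qed.

Lemma cosh_le_exp (x T : R) : Rabs x <= T -> cosh x <= exp T.
Proof.
  intros H. apply Rabs_le_between in H. unfold cosh.
  assert (exp x <= exp T) by (apply exp_mono; lra).
  assert (exp (- x) <= exp T) by (apply exp_mono; lra). lra.
Qed.

Lemma sinh_le (x T : R) : Rabs x <= T -> Rabs (sinh x) <= exp T * Rabs x.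
Proof.
  intros H. destruct (MVT_gen sinh 0 x cosh) as (c & Hc & E).
  - intros. apply is_derive_sinh.
  - intros. eapply is_derive_continuity_pt, is_derive_sinh.
  - rewrite sinh_0, !Rminus_0_r in E. rewrite E, Rabs_mult.
    apply Rmult_le_compat_r; [apply Rabs_pos|].
    assert (H1 := cosh_ge_1 c). rewrite Rabs_pos_eq by lra. apply cosh_le_exp.
    apply Rle_trans with (2 := H). revert Hc. unfold Rmin, Rmax.
    destruct (Rle_dec 0 x); intros Hc.
    + rewrite !Rabs_pos_eq; lra.
    + rewrite !Rabs_left1; lra.
Qed.

Lemma pw_lipschitz_l (m w w' u : R) : 0 < m -> m <= w -> m <= w' ->
  Rabs (pw w' u - pw w u) <= / m ^ 2 * Rabs (w' - w).
Proof.
  intros Hm Hw Hw'.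
  assert (Hmin : m <= Rmin w w') by now apply Rmin_glb.
  destruct (MVT_gen (fun w => pw w u) w w' (fun w => dpw w u)) as (c & Hc & E).
  - intros. apply is_derive_pw_l. lra.
  - intros x Hx. apply (is_derive_continuity_pt (fun w => pw w u) _ (dpw x u)).
    apply is_derive_pw_l. lra.
  - rewrite E, Rabs_mult. apply Rmult_le_compat_r; [apply Rabs_pos|].
    apply dpw_bound; lra.
Qed.

Lemma qw_lipschitz_l (m w w' u : R) : 0 < m -> m <= w -> m <= w' ->
  Rabs (qw w' u - qw w u) <= / m ^ 2 * Rabs (w' - w).
Proof.
  intros Hm Hw Hw'.
  assert (Hmin : m <= Rmin w w') by now apply Rmin_glb.
  destruct (MVT_gen (fun w => qw w u) w w' (fun w => epw w u)) as (c & Hc & E).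
  - intros. apply is_derive_qw_l. lra.
  - intros x Hx. apply (is_derive_continuity_pt (fun w => qw w u) _ (epw x u)).
    apply is_derive_qw_l. lra.
  - rewrite E, Rabs_mult. apply Rmult_le_compat_r; [apply Rabs_pos|].
    apply epw_bound; lra.
Qed.

Lemma pw_lipschitz_r (m w u u' : R) : 0 < m -> m <= w ->
  Rabs (pw w u' - pw w u) <= / m ^ 2 * Rabs (u' - u).
Proof.
  intros Hm Hw.
  destruct (MVT_gen (fun u => pw w u) u u' (fun u => epw w u)) as (c & Hc & E).
  - intros. apply is_derive_pw_r. lra.
  - intros x Hx. apply (is_derive_continuity_pt (fun u => pw w u) _ (epw w x)).
    apply is_derive_pw_r. lra.
  - rewrite E, Rabs_mult. apply Rmult_le_compat_r; [apply Rabs_pos|].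
    apply epw_bound; lra.
Qed.

(* By AM-GM, [a |t| <= e (a^2 + t^2) + a^2 / (4 e)], so the singular term [a |t| / (a^2 + t^2)]
   is at most [e] plus a multiple of a Cauchy density of total mass [O(a)]. *)
Lemma flow_near_zero (w v n a e u : R) : 1 / 2 < w -> 0 < a <= 1 / 4 -> 0 < e ->
  Rabs u <= n ->
  Rabs (flow w v a u - 2 * pw w v * kZ a (u - v)) <=
    (8 + 8 * exp (8 * (n + Rabs v))) / (w - 1 / 2) ^ 2 *
    (e + (1 + / (4 * e)) * (a ^ 2 / (a ^ 2 + (u - v) ^ 2))).
Proof.
  intros Hw Ha He Hu.
  set (m := w - 1 / 2). assert (Hm : 0 < m) by (unfold m; lra).
  set (t := u - v). set (S := exp (8 * (n + Rabs v))).
  assert (HS : 0 < S) by apply exp_pos.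
  assert (HM : 0 < / m ^ 2) by (apply Rinv_0_lt_compat, pow_lt; lra).
  assert (Hq := kQ_lower a t ltac:(lra)).
  assert (Hat : 0 < a ^ 2 + t ^ 2) by (apply sum_sqr_pos; lra).
  assert (H0 := PI_RGT_0). assert (H4 := PI_4).
  (* Here [2 pi <= 8] and [|t| <= n + |v|]; this is the exponent in the constant of the
     statement. *)
  assert (Ht : Rabs (2 * PI * t) <= 8 * (n + Rabs v)).
  { rewrite Rabs_mult, Rabs_pos_eq by lra.
    assert (Rabs t <= n + Rabs v) by (apply Rle_trans with (1 := Rabs_triang _ _); rewrite Rabs_Ropp; lra).
    assert (h := Rabs_pos t). nra. }
  assert (hX : Rabs (sinh (2 * PI * t)) <= S * (8 * Rabs t)).
  { apply Rle_trans with (1 := sinh_le _ _ Ht). apply Rmult_le_compat_l; [lra|].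
    rewrite Rabs_mult, Rabs_pos_eq by lra. apply Rmult_le_compat_r; [apply Rabs_pos|lra]. }
  assert (hZ : Rabs (sin (2 * PI * a)) <= 8 * a).
  { destruct (MVT_gen sin 0 (2 * PI * a) cos) as (c & _ & E).
    - intros. apply is_derive_sin.
    - intros. eapply is_derive_continuity_pt, is_derive_sin.
    - rewrite sin_0, !Rminus_0_r in E. rewrite E, Rabs_mult, (Rabs_pos_eq (2 * PI * a)) by nra.
      assert (Rabs (cos c) <= 1) by (apply Rabs_le, COS_bound).
      rewrite <- (Rmult_1_l (8 * a)). apply Rmult_le_compat; [apply Rabs_pos|nra|assumption|nra]. }
  assert (hp : Rabs (pw (w + a) u + pw (w - a) u - 2 * pw w v) <= 2 * (/ m ^ 2 * (a + Rabs t))).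
  { assert (P1 := pw_lipschitz_l m w (w + a) u Hm ltac:(unfold m; lra) ltac:(unfold m; lra)).
    assert (P2 := pw_lipschitz_l m w (w - a) u Hm ltac:(unfold m; lra) ltac:(unfold m; lra)).
    assert (P3 := pw_lipschitz_r m w v u Hm ltac:(unfold m; lra)).
    replace (w + a - w) with a in P1 by ring. rewrite (Rabs_pos_eq a) in P1 by lra.
    replace (w - a - w) with (- a) in P2 by ring. rewrite Rabs_Ropp, (Rabs_pos_eq a) in P2 by lra.
    fold t in P3.
    apply Rabs_le_between in P1. apply Rabs_le_between in P2. apply Rabs_le_between in P3.
    apply Rabs_le. lra. }
  assert (hq : Rabs (qw (w + a) u - qw (w - a) u) <= / m ^ 2 * (2 * a)).
  { assert (P := qw_lipschitz_l m (w - a) (w + a) u Hm ltac:(unfold m; lra) ltac:(unfold m; lra)).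
    replace (w + a - (w - a)) with (2 * a) in P by ring. rewrite (Rabs_pos_eq (2 * a)) in P by lra. exact P. }
  (* Once the main term is subtracted, each product in the numerator has a factor of order [a] and a
     factor that also vanishes at the pole [a = t = 0]. The numerator is thus [O(a^2 + a |t|)],
     against a denominator of size at least [2 (a^2 + t^2)]. *)
  assert (E : flow w v a u - 2 * pw w v * kZ a t =
    (sin (2 * PI * a) * (pw (w + a) u + pw (w - a) u - 2 * pw w v)
     - sinh (2 * PI * t) * (qw (w + a) u - qw (w - a) u)) / kQ a t)
    by (unfold flow, kZ, kX; fold t; field; lra).
  rewrite E. apply Rabs_div_le; [lra|].
  assert (hN : Rabs (sin (2 * PI * a) * (pw (w + a) u + pw (w - a) u - 2 * pw w v)
     - sinh (2 * PI * t) * (qw (w + a) u - qw (w - a) u))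
     <= 2 * ((8 + 8 * S) * / m ^ 2 * (a ^ 2 + a * Rabs t))).
  { apply Rle_trans with (1 := Rabs_triang _ _). rewrite Rabs_Ropp, !Rabs_mult.
    apply Rle_trans with (8 * a * (2 * (/ m ^ 2 * (a + Rabs t))) + S * (8 * Rabs t) * (/ m ^ 2 * (2 * a))).
    - apply Rplus_le_compat; apply Rmult_le_compat; auto using Rabs_pos.
    - assert (0 <= S * / m ^ 2 * a ^ 2) by (apply Rmult_le_pos; [nra|apply pow2_ge_0]).
      assert (h := Rabs_pos t). lra. }
  apply Rle_trans with (1 := hN).
  apply Rle_trans with ((8 + 8 * S) / m ^ 2 * (e + (1 + / (4 * e)) * (a ^ 2 / (a ^ 2 + t ^ 2)))
    * (2 * (a ^ 2 + t ^ 2))).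
  - replace ((8 + 8 * S) / m ^ 2 * (e + (1 + / (4 * e)) * (a ^ 2 / (a ^ 2 + t ^ 2)))
      * (2 * (a ^ 2 + t ^ 2))) with
      (2 * ((8 + 8 * S) * / m ^ 2 * (e * (a ^ 2 + t ^ 2) + a ^ 2 + a ^ 2 / (4 * e))))
      by (field; repeat split; lra).
    apply Rmult_le_compat_l; [lra|]. apply Rmult_le_compat_l; [apply Rmult_le_pos; lra|].
    enough (a * Rabs t <= e * t ^ 2 + a ^ 2 / (4 * e)) by nra.
    rewrite <- (pow2_abs t). assert (h := pow2_ge_0 (2 * e * Rabs t - a)).
    apply Rmult_le_reg_l with (4 * e); [lra|].
    replace (4 * e * (e * Rabs t ^ 2 + a ^ 2 / (4 * e))) with (4 * e ^ 2 * Rabs t ^ 2 + a ^ 2)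
      by (field; lra). nra.
  - apply Rmult_le_compat_l; [|assumption].
    assert (0 < / (4 * e)) by (apply Rinv_0_lt_compat; lra).
    assert (0 <= a ^ 2 / (a ^ 2 + t ^ 2))
      by (apply Rmult_le_pos; [apply pow2_ge_0|left; now apply Rinv_0_lt_compat]).
    apply Rmult_le_pos; [apply Rmult_le_pos; [lra|lra]|].
    assert (0 <= (1 + / (4 * e)) * (a ^ 2 / (a ^ 2 + t ^ 2))) by (apply Rmult_le_pos; lra). lra.
Qed.

(** [coth (pi z)] is the derivative of [log (sinh (pi z)) / pi], so its imaginary part integrates to
    [/ pi] times the argument of [sinh (pi (t - i a))]. Up to a constant, that argument is written
    as an [atan] that is smooth across [t = 0]. *)
Lemma is_derive_atan_kZ (a t : R) : 0 < a < 1 ->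
  is_derive (fun t => / PI * atan (cos (PI * a) / sin (PI * a) * (sinh (PI * t) / cosh (PI * t))))
    t (kZ a t).
Proof.
  intros Ha. assert (HQ := kQ_pos a t Ha). assert (H0 := PI_RGT_0).
  assert (Hs : 0 < sin (PI * a)) by (apply sin_gt_0; nra).
  assert (Hc := cosh_ge_1 (PI * t)).
  evar_last.
  - apply (is_derive_scal (fun t => atan _)), (is_derive_comp atan); [apply is_derive_atan_lor|].
    apply (is_derive_scal (fun t => sinh (PI * t) / cosh (PI * t))).
    apply (is_derive_div (fun t => sinh (PI * t)));
      [apply is_derive_scaled, is_derive_sinh|apply is_derive_scaled, is_derive_cosh|lra].
  - unfold scal; simpl. unfold mult; simpl. unfold kZ, lor.
    replace (2 * PI * a) with (2 * (PI * a)) by ring. rewrite sin_2a, kQ_eq in *.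
    assert (E1 := cosh_sqr (PI * t)). assert (E2 := sin2_cos2 (PI * a)). unfold Rsqr in E2.
    set (s := sin (PI * a)) in *. set (c := cos (PI * a)) in *.
    set (S := sinh (PI * t)) in *. set (C := cosh (PI * t)) in *.
    replace (PI * C * C - S * (PI * S)) with PI by nra.
    replace (1 + (c / s * (S / C)) ^ 2) with ((S ^ 2 + s ^ 2) / (s ^ 2 * C ^ 2)).
    + field. repeat split; lra.
    + replace (S ^ 2 + s ^ 2) with (s ^ 2 * C ^ 2 + c ^ 2 * S ^ 2) by nra. field. lra.
Qed.

(** [pi / 2 - atan x = atan (/ x) <= / x], and here [/ x = tan (pi a) coth (pi t) <= 8 a * 2]. *)
Lemma atan_cot_ge (a t : R) : 0 < a <= 1 / 4 -> 1 <= t ->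
  0 <= PI / 2 - atan (cos (PI * a) / sin (PI * a) * (sinh (PI * t) / cosh (PI * t))) <= 16 * a.
Proof.
  intros Ha Ht. assert (H0 := PI_gt_3). assert (H4 := PI_4).
  assert (Hs : 0 < sin (PI * a)) by (apply sin_gt_0; nra).
  assert (Hs2 : sin (PI * a) <= 4 * a).
  { apply Rle_trans with (PI * a); [left; apply sin_lt_x; nra|nra]. }
  assert (Hc : 1 / 2 <= cos (PI * a)) by (rewrite <- cos_PI3; apply cos_decr_1; nra).
  assert (HC := cosh_ge_1 (PI * t)). assert (HS := sinh_ge (PI * t) ltac:(nra)).
  assert (E := cosh_sqr (PI * t)).
  assert (HS3 : 3 <= sinh (PI * t)) by nra.
  assert (HT : cosh (PI * t) <= 2 * sinh (PI * t)) by nra.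
  set (x := cos (PI * a) / sin (PI * a) * (sinh (PI * t) / cosh (PI * t))).
  assert (Hx : 0 < x).
  { unfold x. apply Rmult_lt_0_compat; apply Rdiv_lt_0_compat; nra. }
  assert (Hix : / x <= 16 * a).
  { replace (/ x) with (sin (PI * a) / cos (PI * a) * (cosh (PI * t) / sinh (PI * t)))
      by (unfold x; field; repeat split; nra).
    replace (16 * a) with (8 * a * 2) by ring.
    apply Rmult_le_compat.
    - left. apply Rdiv_lt_0_compat; lra.
    - left. apply Rdiv_lt_0_compat; nra.
    - apply Rmult_le_reg_r with (cos (PI * a)); [lra|].
      replace (sin (PI * a) / cos (PI * a) * cos (PI * a)) with (sin (PI * a)) by (field; lra). nra.
    - apply Rmult_le_reg_r with (sinh (PI * t)); [nra|].
      replace (cosh (PI * t) / sinh (PI * t) * sinh (PI * t)) with (cosh (PI * t)) by (field; nra). lra. }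
  split; [assert (h := atan_bound x); lra|].
  assert (h := atan_tail x (x + 16 * a)). rewrite <- (atan_inv x Hx).
  destruct (MVT_gen atan 0 (/ x) lor) as (c & _ & Ec).
  - intros. apply is_derive_atan_lor.
  - intros. eapply is_derive_continuity_pt, is_derive_atan_lor.
  - assert (h1 := lor_le_1 c). assert (h2 := Rinv_0_lt_compat _ Hx). rewrite atan_0 in Ec. nra.
Qed.

(** Unit mass of the approximate identity: each end of the primitive misses [1 / 2] in absolute
    value by at most [16 a / pi]. *)
Lemma RInt_kZ (v n a : R) : Rabs v + 1 <= n -> 0 < a <= 1 / 4 ->
  Rabs (RInt (fun u => kZ a (u - v)) (- n) n - 1) <= 32 * a.
Proof.
  intros Hn Ha. assert (Hv1 := Rle_abs v). assert (Hv2 := Rle_abs (- v)).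
  rewrite Rabs_Ropp in Hv2. assert (H0 := PI_gt_3).
  set (G := fun t => atan (cos (PI * a) / sin (PI * a) * (sinh (PI * t) / cosh (PI * t)))).
  assert (E : RInt (fun u => kZ a (u - v)) (- n) n = / PI * G (n - v) - / PI * G (- n - v)).
  { apply is_RInt_unique, (is_RInt_derive (fun u => / PI * G (u - v))).
    - intros u _. apply (is_derive_shift (fun t => / PI * G t)), is_derive_atan_kZ. lra.
    - intros u _. eapply continuous_of_is_derive, (is_derive_shift (kZ a)), is_derive_kZ_r. lra. }
  assert (Godd : G (- n - v) = - G (n + v)).
  { unfold G. rewrite <- atan_opp. f_equal. replace (PI * (- n - v)) with (- (PI * (n + v))) by ring.
    rewrite sinh_opp, cosh_opp. unfold Rdiv. ring. }
  assert (G1 := atan_cot_ge a (n - v) Ha ltac:(lra)). fold (G (n - v)) in G1.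
  assert (G2 := atan_cot_ge a (n + v) Ha ltac:(lra)). fold (G (n + v)) in G2.
  rewrite E, Godd.
  replace (_ - 1) with (- ((PI / 2 - G (n - v) + (PI / 2 - G (n + v))) / PI)) by (field; lra).
  rewrite Rabs_Ropp. apply Rabs_div_le; [lra|]. apply Rabs_le. nra.
Qed.

Lemma RInt_cauchy_le (v n a : R) : 0 < a -> - n <= n ->
  RInt (fun u => a ^ 2 / (a ^ 2 + (u - v) ^ 2)) (- n) n <= 4 * a.
Proof.
  intros Ha Hn.
  assert (E : RInt (fun u => a ^ 2 / (a ^ 2 + (u - v) ^ 2)) (- n) n
    = a * atan (/ a * (n - v)) - a * atan (/ a * (- n - v))).
  { assert (D : forall u, is_derive (fun u => a * atan (/ a * (u - v))) u (a ^ 2 / (a ^ 2 + (u - v) ^ 2))).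
    { intros u. assert (H := sum_sqr_pos a (u - v) ltac:(lra)). evar_last.
      - apply (is_derive_shift (fun t => a * atan (/ a * t))).
        apply (is_derive_scal (fun t => atan (/ a * t))), is_derive_scaled, is_derive_atan_lor.
      - unfold lor.
        replace (1 + (/ a * (u - v)) ^ 2) with ((a ^ 2 + (u - v) ^ 2) / a ^ 2) by (field; lra).
        field. lra. }
    apply is_RInt_unique, (is_RInt_derive (fun u => a * atan (/ a * (u - v)))).
    - intros u _. apply D.
    - intros u _. apply (ex_derive_continuous (fun u => a ^ 2 / (a ^ 2 + (u - v) ^ 2))).
      assert (H := sum_sqr_pos a (u - v) ltac:(lra)). auto_derive. simpl in H |- *. lra. }
  rewrite E. assert (H := atan_diff_le (/ a * (- n - v)) (/ a * (n - v))). assert (H4 := PI_4). nra.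
Qed.

(** For fixed [n], the integral at [1/2] is compared with that at [a], then with [2 pw w v] times
    the integral of [kZ a], then with [2 pw w v]. As [a -> 0] only the error of the first comparison
    survives. *)
Lemma flow_half_limit (w v n : R) : 1 / 2 < w -> Rabs v + 1 <= n ->
  Rabs (RInt (flow w v (1 / 2)) (- n) n - 2 * pw w v) <= 6 / n.
Proof.
  intros Hw Hn. assert (Hv := Rabs_pos v).
  set (K := (8 + 8 * exp (8 * (n + Rabs v))) / (w - 1 / 2) ^ 2).
  assert (HK : 0 < K).
  { apply Rdiv_lt_0_compat; [assert (h := exp_pos (8 * (n + Rabs v))); lra|apply pow_lt; lra]. }
  (* With [a = e^2] all errors are [O(e)]: [K * 2 n e] from the constant term over [[-n, n]],
     [K (1 + / (4 e)) * 4 e^2 = K (4 e + 1) e] from the Cauchy part, and [64 |pw w v| e^2] from the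
     mass of [kZ]. The bound [e <= 1 / 2] ensures [a <= 1 / 4]. *)
  set (L := K * (2 * n + 5) + 64 * Rabs (pw w v)).
  assert (HL : 0 < L + 1) by (unfold L; assert (h := Rabs_pos (pw w v)); nra).
  apply Rle_plus_epsilon. intros eps Heps.
  set (e := Rmin (1 / 2) (eps / (L + 1))).
  assert (He : 0 < e) by (apply Rmin_glb_lt; [lra|now apply Rdiv_lt_0_compat]).
  assert (He1 : e <= 1 / 2) by apply Rmin_l.
  assert (He2 : L * e <= eps).
  { apply Rle_trans with ((L + 1) * (eps / (L + 1))); [|right; field; lra].
    apply Rle_trans with ((L + 1) * e); [nra|].
    apply Rmult_le_compat_l; [lra|apply Rmin_r]. }
  assert (Ha : 0 < e ^ 2 <= 1 / 4) by nra.
  set (a := e ^ 2) in *.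
  assert (H1 := flow_half_approx w v n a Hw Hn ltac:(lra)).
  assert (H2 := RInt_kZ v n a Hn Ha).
  assert (CF : forall u, continuous (flow w v a) u) by (intros; apply continuous_flow; lra).
  assert (CZ : forall u, continuous (fun u => kZ a (u - v)) u).
  { intros u. eapply continuous_of_is_derive, (is_derive_shift (kZ a)), is_derive_kZ_r. lra. }
  assert (CC : forall u, continuous (fun u => a ^ 2 / (a ^ 2 + (u - v) ^ 2)) u).
  { intros u. apply (ex_derive_continuous (fun u => a ^ 2 / (a ^ 2 + (u - v) ^ 2))).
    assert (H := sum_sqr_pos a (u - v) ltac:(lra)). auto_derive. simpl in H |- *. lra. }
  assert (H3 : Rabs (RInt (flow w v a) (- n) n - 2 * pw w v * RInt (fun u => kZ a (u - v)) (- n) n)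
     <= K * (2 * n + 5) * e).
  { replace (2 * pw w v * RInt (fun u => kZ a (u - v)) (- n) n)
      with (RInt (fun u => scal (2 * pw w v) (kZ a (u - v))) (- n) n)
      by (apply (RInt_scal (fun u => kZ a (u - v))), ex_RInt_cont, CZ).
    assert (CZ' : forall u, continuous (fun u => scal (2 * pw w v) (kZ a (u - v))) u).
    { intros u. apply (continuous_scal_r (2 * pw w v) (fun u => kZ a (u - v))), CZ. }
    rewrite <- (RInt_minus (flow w v a)) by now apply ex_RInt_cont.
    assert (CM : forall u, continuous (fun u => minus (flow w v a u) (scal (2 * pw w v) (kZ a (u - v)))) u).
    { intros u. now apply (continuous_minus (flow w v a)). }
    apply Rle_trans with (RInt (fun u => K * e + K * (1 + / (4 * e)) * (a ^ 2 / (a ^ 2 + (u - v) ^ 2))) (- n) n).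
    - apply Rle_trans with (1 := abs_RInt_le _ (- n) n ltac:(lra) (ex_RInt_cont _ _ _ CM)).
      apply RInt_le; [lra| | |].
      + apply ex_RInt_cont. intros u. apply continuous_comp; [apply CM|apply continuous_Rabs].
      + apply ex_RInt_cont. intros u. apply (continuous_plus (fun _ => K * e)).
        * apply continuous_const.
        * apply (continuous_scal_r (K * (1 + / (4 * e))) (fun u => a ^ 2 / (a ^ 2 + (u - v) ^ 2))), CC.
      + intros u Hu.
        assert (H := flow_near_zero w v n a e u Hw Ha He ltac:(apply Rabs_le; lra)).
        fold K in H. apply Rle_trans with (1 := H). right. ring.
    - rewrite (RInt_plus (fun _ => K * e)).
      + rewrite RInt_const, (RInt_scal (fun u => a ^ 2 / (a ^ 2 + (u - v) ^ 2))) by now apply ex_RInt_cont.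
        change ((n - - n) * (K * e) + K * (1 + / (4 * e)) * RInt (fun u => a ^ 2 / (a ^ 2 + (u - v) ^ 2)) (- n) n
          <= K * (2 * n + 5) * e).
        assert (H := RInt_cauchy_le v n a ltac:(lra) ltac:(lra)).
        assert (Hi : 0 < / (4 * e)) by (apply Rinv_0_lt_compat; lra).
        apply Rle_trans with ((n - - n) * (K * e) + K * (1 + / (4 * e)) * (4 * a)).
        * apply Rplus_le_compat_l, Rmult_le_compat_l; [nra|assumption].
        * unfold a. replace ((n - - n) * (K * e) + K * (1 + / (4 * e)) * (4 * e ^ 2))
            with (K * (2 * n + (4 * e + 1)) * e) by (field; lra).
          apply Rmult_le_compat_r; [lra|]. apply Rmult_le_compat_l; lra.
      + apply ex_RInt_const.
      + apply ex_RInt_cont. intros u.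
        apply (continuous_scal_r (K * (1 + / (4 * e))) (fun u => a ^ 2 / (a ^ 2 + (u - v) ^ 2))), CC. }
  set (Z := RInt (fun u => kZ a (u - v)) (- n) n) in *.
  assert (H4 : Rabs (2 * pw w v * Z - 2 * pw w v) <= 64 * Rabs (pw w v) * e).
  { replace (2 * pw w v * Z - 2 * pw w v) with (2 * pw w v * (Z - 1)) by ring.
    rewrite !Rabs_mult, (Rabs_pos_eq 2) by lra. assert (h := Rabs_pos (pw w v)).
    apply Rle_trans with (2 * Rabs (pw w v) * (32 * a)); [apply Rmult_le_compat_l; lra|].
    unfold a. replace (2 * Rabs (pw w v) * (32 * e ^ 2)) with (64 * Rabs (pw w v) * (e * e)) by ring.
    apply Rmult_le_compat_l; nra. }
  apply Rabs_le_between in H1. apply Rabs_le_between in H3. apply Rabs_le_between in H4.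
  apply Rabs_le. unfold L in He2. lra.
Qed.

(** * From the kernel back to the logistic average *)

Definition hlog (w u : R) : R := ln (w ^ 2 + u ^ 2) / 2.

Lemma is_derive_hlog_l (w u : R) : w <> 0 -> is_derive (fun w => hlog w u) w (pw w u).
Proof.
  intros H. apply (sum_sqr_pos w u) in H. unfold hlog, pw.
  auto_derive; [lra | field; lra].
Qed.

Lemma is_derive_hlog_r (w u : R) : w <> 0 -> is_derive (fun u => hlog w u) u (qw w u).
Proof.
  intros H. apply (sum_sqr_pos w u) in H. unfold hlog, qw.
  auto_derive; [lra | field; lra].
Qed.

Definition hdiff (w u : R) : R := hlog (w + 1 / 2) u - hlog (w - 1 / 2) u.

Lemma is_derive_hdiff (w u : R) : 1 / 2 < w ->
  is_derive (hdiff w) u (qw (w + 1 / 2) u - qw (w - 1 / 2) u).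
Proof.
  intros Hw. apply (is_derive_Rminus (fun u => hlog (w + 1 / 2) u)); apply is_derive_hlog_r; lra.
Qed.

(** As a value of [pw], the difference is bounded and decays like [1 / |u|], although [hlog] grows.
    Boundedness makes it integrable against [rho1]; the decay removes the boundary terms of the
    integration by parts. *)
Lemma hdiff_mvt (w u : R) : 1 / 2 < w -> exists c, w - 1 / 2 <= c <= w + 1 / 2 /\ hdiff w u = pw c u.
Proof.
  intros Hw.
  destruct (MVT_gen (fun w => hlog w u) (w - 1 / 2) (w + 1 / 2) (fun w => pw w u)) as (c & Hc & E).
  - rewrite Rmin_left, Rmax_right by lra. intros. apply is_derive_hlog_l. lra.
  - rewrite Rmin_left, Rmax_right by lra. intros x Hx.
    apply (is_derive_continuity_pt (fun w => hlog w u) x (pw x u)), is_derive_hlog_l. lra.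
  - rewrite Rmin_left, Rmax_right in Hc by lra. exists c. split; [assumption|].
    unfold hdiff. transitivity (pw c u * (w + 1 / 2 - (w - 1 / 2))); [exact E|field].
Qed.

Lemma sqr_le_sum_sqr (m w u : R) : 0 < m -> m <= Rabs w -> m ^ 2 <= w ^ 2 + u ^ 2.
Proof.
  intros Hm Hw. rewrite <- (pow2_abs w). assert (h := pow2_ge_0 u). nra.
Qed.

Lemma pw_bounded (m w u : R) : 0 < m -> m <= Rabs w -> Rabs (pw w u) <= / m.
Proof.
  intros Hm Hw. assert (H := sqr_le_sum_sqr m w u Hm Hw). assert (Hm2 := pow_lt m 2 Hm).
  apply Rabs_div_le; [lra|]. apply Rmult_le_reg_l with m; [assumption|].
  rewrite <- Rmult_assoc, Rinv_r, Rmult_1_l by lra. rewrite <- (pow2_abs w).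
  assert (h := pow2_ge_0 u). nra.
Qed.

Lemma hdiff_bound (w u : R) : 1 / 2 < w -> Rabs (hdiff w u) <= / (w - 1 / 2).
Proof.
  intros Hw. destruct (hdiff_mvt w u Hw) as (c & Hc & ->).
  apply pw_bounded; [lra|]. rewrite Rabs_pos_eq; lra.
Qed.

Lemma kX_half_tanh (t : R) : ekX (1 / 2) t = 2 * rho1 t.
Proof.
  assert (HQ := kQ_pos (1 / 2) t ltac:(lra)). unfold ekX, rho1.
  assert (E : kQ (1 / 2) t = 2 * cosh (PI * t) ^ 2).
  { rewrite kQ_eq, cosh_sqr. replace (PI * (1 / 2)) with (PI / 2) by field. rewrite sin_PI2. ring. }
  rewrite E. replace (2 * PI * (1 / 2)) with PI by field. rewrite cos_PI.
  replace (2 * PI * t) with (2 * (PI * t)) by ring. rewrite cosh_double.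
  assert (E2 := cosh_sqr (PI * t)). assert (h := cosh_ge_1 (PI * t)).
  replace (1 - (1 + 2 * sinh (PI * t) ^ 2) * -1) with (2 * cosh (PI * t) ^ 2) by (rewrite E2; ring).
  field. lra.
Qed.

Lemma flow_half (w v u : R) :
  flow w v (1 / 2) u = - kX (1 / 2) (u - v) * (qw (w + 1 / 2) u - qw (w - 1 / 2) u).
Proof.
  unfold flow, kZ. replace (2 * PI * (1 / 2)) with PI by field. rewrite sin_PI. unfold Rdiv. ring.
Qed.

(* Integration by parts: [kX (1/2)] is [tanh (pi t)], twice a primitive of [rho1]. *)
Lemma int_R_hdiff_rho1 (w v : R) : 1 / 2 < w ->
  int_R (fun u => hdiff w u * rho1 (u - v)) = pw w v.
Proof.
  intros Hw.
  assert (Ch : forall u, continuous (hdiff w) u)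
    by (intros; eapply continuous_of_is_derive; now apply is_derive_hdiff).
  assert (Cr : forall u, continuous (fun u => rho1 (u - v)) u)
    by (intros; apply continuous_shift', continuous_rho1).
  assert (Chr : forall u, continuous (fun u => hdiff w u * rho1 (u - v)) u)
    by (intros; now apply (continuous_mult (hdiff w))).
  assert (Hlor : forall u, lor (u - v) <= 2 * (1 + v ^ 2) * lor u).
  { intros u. assert (H := lor_mul_le v (u - v)). replace (v + (u - v)) with u in H by ring.
    assert (E : lor (u - v) = (1 + v ^ 2) * (lor v * lor (u - v))).
    { unfold lor at 2. field. assert (h := pow2_ge_0 v). lra. }
    rewrite E. assert (h := pow2_ge_0 v). nra. }
  (* The rate [5 / n] is half of the [6 / n] from [flow_half_limit], plus [1 / n] for the boundary
     term [B] at each end. *)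
  apply int_R_eq_of_approx with (/ (w - 1 / 2) * (4 * (1 + v ^ 2))) 5 (Rabs v + 1).
  - split; [assumption|]. intros u. rewrite Rabs_mult.
    assert (h := rho1_pos (u - v)). rewrite (Rabs_pos_eq (rho1 _)) by lra.
    rewrite Rmult_assoc. apply Rmult_le_compat; [apply Rabs_pos|lra|now apply hdiff_bound|].
    assert (h1 := rho1_le_lor (u - v)). specialize (Hlor u). lra.
  - intros n Hn Hn0.
    assert (Hv := Rabs_pos v). assert (Hv1 := Rle_abs v). assert (Hv2 := Rle_abs (- v)).
    rewrite Rabs_Ropp in Hv2.
    set (B := fun u => / 2 * (hdiff w u * kX (1 / 2) (u - v))).
    assert (CF : forall u, continuous (flow w v (1 / 2)) u) by (intros; apply continuous_flow; lra).
    assert (E : RInt (fun u => hdiff w u * rho1 (u - v) - / 2 * flow w v (1 / 2) u) (- n) n = B n - B (- n)).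
    { apply is_RInt_unique, (is_RInt_derive B).
      - intros u _. unfold B. evar_last.
        + apply (is_derive_scal (fun u => hdiff w u * kX (1 / 2) (u - v))).
          apply (is_derive_Rmult (hdiff w) (fun u => kX (1 / 2) (u - v))).
          * now apply is_derive_hdiff.
          * apply (is_derive_shift (kX (1 / 2))), is_derive_kX_r. lra.
        + rewrite flow_half, kX_half_tanh. unfold scal; simpl. unfold mult; simpl. field.
      - intros u _. apply (continuous_minus (fun u => hdiff w u * rho1 (u - v))); [apply Chr|].
        apply (continuous_scal_r (/ 2) (flow w v (1 / 2))), CF. }
    rewrite (RInt_minus (fun u => hdiff w u * rho1 (u - v))) in E.
    2:{ now apply ex_RInt_cont. }
    2:{ apply ex_RInt_cont. intros u. apply (continuous_scal_r (/ 2) (flow w v (1 / 2))), CF. }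
    rewrite (RInt_scal (flow w v (1 / 2))) in E by now apply ex_RInt_cont.
    change (RInt (fun u => hdiff w u * rho1 (u - v)) (- n) n - / 2 * RInt (flow w v (1 / 2)) (- n) n = B n - B (- n)) in E.
    assert (H := flow_half_limit w v n Hw Hn0).
    assert (HB : forall u, 1 <= Rabs (u - v) -> Rabs u = n -> Rabs (B u) <= / n).
    { intros u Hu Hun. assert (h1 := kX_bound (1 / 2) _ Hu).
      destruct (hdiff_mvt w u Hw) as (c & Hc & Ec).
      assert (Hu0 : u <> 0) by (intros ->; rewrite Rabs_R0 in Hun; lra).
      assert (h2 := pw_le_inv c u ltac:(lra) Hu0). rewrite <- Ec, Hun in h2.
      unfold B, Rdiv. rewrite !Rabs_mult, (Rabs_pos_eq (/ 2)) by lra.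
      replace (/ n) with (/ 2 * (/ n * 2)) by (field; lra).
      apply Rmult_le_compat_l; [lra|]. apply Rmult_le_compat; auto using Rabs_pos. }
    assert (B1 := HB n ltac:(rewrite Rabs_pos_eq; lra) ltac:(rewrite Rabs_pos_eq; lra)).
    assert (B2 := HB (- n) ltac:(rewrite Rabs_left; lra) ltac:(rewrite Rabs_left; lra)).
    apply Rabs_le_between in B1. apply Rabs_le_between in B2. apply Rabs_le_between in H.
    unfold Rdiv in H. apply Rabs_le. unfold Rdiv. lra.
Qed.

(** * Expectations and the functions [E log |w + i U_n|] *)

(* [rho_0] is the Dirac mass at [0]. *)
Definition expect (n : nat) (f : R -> R) : R :=
  match n with
  | O => f 0
  | S m => int_R (fun u => f u * rho_aux m u)
  end.

Definition tame (f : R -> R) : Prop :=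
  (forall x, continuous f x) /\ exists B, forall u, Rabs (f u) <= B * (1 + u ^ 2).

Lemma tame_dom (f : R -> R) (m : nat) : tame f -> exists C, dom C (fun u => f u * rho_aux m u).
Proof.
  intros [Hc [B HB]]. destruct (rho_aux_decaying m) as [C HC].
  exists (B * C). split.
  - intros x. apply (continuous_mult f (rho_aux m)); [apply Hc|apply HC].
  - intros u. rewrite Rabs_mult, (Rabs_pos_eq (rho_aux m u)) by apply HC.
    assert (h : 0 < 1 + u ^ 2) by (assert (h := pow2_ge_0 u); lra).
    replace (B * C * lor u) with (B * (1 + u ^ 2) * (C * lor u ^ 2)) by (unfold lor; field; lra).
    apply Rmult_le_compat; [apply Rabs_pos|apply HC|apply HB|apply HC].
Qed.

Lemma expect_ext (n : nat) (f g : R -> R) : (forall u, f u = g u) -> expect n f = expect n g.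
Proof. intros H. f_equal. now apply functional_extensionality. Qed.

Lemma expect_minus (n : nat) (f g : R -> R) : tame f -> tame g ->
  expect n (fun u => f u - g u) = expect n f - expect n g.
Proof.
  intros Hf Hg. destruct n as [|m]; [reflexivity|]. simpl.
  destruct (tame_dom f m Hf) as [C HC]. destruct (tame_dom g m Hg) as [D HD].
  rewrite <- (int_R_minus C D) by assumption. apply int_R_ext. intros u. ring.
Qed.

Lemma expect_scal (n : nat) (k : R) (f : R -> R) : tame f ->
  expect n (fun u => k * f u) = k * expect n f.
Proof.
  intros Hf. destruct n as [|m]; [reflexivity|]. simpl.
  destruct (tame_dom f m Hf) as [C HC].
  rewrite <- (int_R_scal C) by assumption. apply int_R_ext. intros u. ring.
Qed.

Lemma tame_sqr : tame (fun u => u ^ 2).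
Proof.
  split.
  - intros x. apply (ex_derive_continuous (fun u : R => u ^ 2)). auto_derive. exact I.
  - exists 1. intros u. rewrite Rabs_pos_eq by apply pow2_ge_0. lra.
Qed.

(** Used with [B] of order [/ w^2]: the second moment then controls the behaviour of [digam] and its
    derivatives at infinity, including for the Dirac mass. *)
Lemma expect_le_sqr (n : nat) (B : R) (f : R -> R) : tame f ->
  (forall u, Rabs (f u) <= B * u ^ 2) -> Rabs (expect n f) <= B * expect n (fun u => u ^ 2).
Proof.
  intros Hf H. destruct n as [|m]; [apply H|].
  rewrite <- expect_scal by apply tame_sqr.
  change (Rabs (int_R (fun u => f u * rho_aux m u)) <= int_R (fun u => B * u ^ 2 * rho_aux m u)).
  destruct (tame_dom f m Hf) as [C HC]. destruct (tame_dom _ m tame_sqr) as [D HD].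
  destruct (rho_aux_decaying m) as [c Hr].
  assert (HD' := dom_scal _ B _ HD).
  replace (fun u => B * u ^ 2 * rho_aux m u) with (fun u => B * (u ^ 2 * rho_aux m u))
    by (apply functional_extensionality; intros u; ring).
  eapply int_R_abs_le; [exact HC|exact HD'|].
  intros u. rewrite Rabs_mult, (Rabs_pos_eq (rho_aux m u)) by apply Hr.
  rewrite <- Rmult_assoc. apply Rmult_le_compat_r; [apply Hr|apply H].
Qed.

(** Fubini for a sum of independent variables: [g v] is the average of [f] over [v] plus a logistic
    variable. *)
Lemma expect_succ (n : nat) (B : R) (f g : R -> R) :
  (forall u, continuous f u) -> (forall u, Rabs (f u) <= B) -> (forall v, continuous g v) ->
  (forall v, int_R (fun u => f u * rho1 (u - v)) = g v) ->
  expect (S n) f = expect n g.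
Proof.
  intros Hf HB Hg Hfg. destruct n as [|m]; simpl.
  - rewrite <- Hfg. apply int_R_ext. intros u. now rewrite Rminus_0_r.
  - destruct (rho_aux_decaying m) as [C HC]. assert (HC0 := decaying_const_nonneg _ _ HC).
    assert (HB0 : 0 <= B) by (apply Rle_trans with (2 := HB 0); apply Rabs_pos).
    set (F := fun u v => f u * (rho_aux m v * rho1 (u - v))).
    (* [EA] and [EB] evaluate both partial integrals of [F]; the continuity that [int_R_swap] asks
       for is read off from these closed forms. *)
    assert (EA : forall u, int_R (F u) = f u * rho_aux (S m) u).
    { intros u. apply (int_R_scal (2 * C) (f u)). now apply dom_conv. }
    assert (Dv : forall v, exists D, dom D (fun u => f u * rho1 (u - v))).
    { intros v. exists (B * (4 * (1 + v ^ 2))). split.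
      - intros u. apply (continuous_mult f (fun u => rho1 (u - v))); [apply Hf|].
        apply continuous_shift', continuous_rho1.
      - intros u. rewrite Rabs_mult. assert (h := rho1_pos (u - v)).
        rewrite (Rabs_pos_eq (rho1 _)) by lra. rewrite Rmult_assoc.
        apply Rmult_le_compat; [apply Rabs_pos|lra|apply HB|].
        assert (h1 := rho1_le_lor (u - v)). assert (h2 := lor_mul_le v (u - v)).
        replace (v + (u - v)) with u in h2 by ring. assert (h3 := pow2_ge_0 v).
        assert (E : lor (u - v) = (1 + v ^ 2) * (lor v * lor (u - v)))
          by (unfold lor at 2; field; lra).
        nra. }
    assert (EB : forall v, int_R (fun u => F u v) = g v * rho_aux m v).
    { intros v. destruct (Dv v) as [D HD]. rewrite <- Hfg, Rmult_comm, <- (int_R_scal D) by assumption.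
      apply int_R_ext. intros u. unfold F. ring. }
    transitivity (int_R (fun u => int_R (F u))).
    { apply int_R_ext. intros u. now rewrite EA. }
    rewrite (int_R_swap (4 * B * C) F).
    + apply int_R_ext, EB.
    + intros u v. apply continuity_2d_pt_mult; [now apply (continuity_2d_pt_fst f)|].
      apply continuity_2d_pt_mult; [apply (continuity_2d_pt_snd (rho_aux m)), HC|].
      apply (continuity_1d_2d_pt_comp rho1 (fun u v => u - v)).
      * eapply is_derive_continuity_pt, is_derive_rho1.
      * apply continuity_2d_pt_minus; [apply continuity_2d_pt_id1|apply continuity_2d_pt_id2].
    + intros u v. unfold F. assert (h := rho1_pos (u - v)). assert (h0 := decaying_ge_0 _ _ HC v).
      rewrite Rabs_mult, (Rabs_pos_eq (_ * _)) by nra.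
      replace (4 * B * C * lor u * lor v) with (B * (4 * C * (lor u * lor v))) by ring.
      apply Rmult_le_compat; [apply Rabs_pos|nra|apply HB|].
      apply Rle_trans with ((C * lor v ^ 2) * (2 * lor (u - v))).
      * apply Rmult_le_compat; [assumption|lra|apply HC|apply rho1_le_lor].
      * assert (h2 := lor_mul_le v (u - v)). replace (v + (u - v)) with u in h2 by ring.
        replace (C * lor v ^ 2 * (2 * lor (u - v))) with (C * lor v * 2 * (lor v * lor (u - v))) by ring.
        replace (4 * C * (lor u * lor v)) with (C * lor v * 2 * (2 * lor u)) by ring.
        apply Rmult_le_compat_l; [|assumption]. assert (h3 := lor_pos v). nra.
    + intros u. apply continuous_ext with (fun u => f u * rho_aux (S m) u).
      * intros t. symmetry. apply EA.
      * destruct (rho_aux_decaying (S m)) as [C' HC'].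
        apply (continuous_mult f (rho_aux (S m))); [apply Hf|apply HC'].
    + intros v. apply continuous_ext with (fun v => g v * rho_aux m v).
      * intros t. symmetry. apply EB.
      * apply (continuous_mult g (rho_aux m)); [apply Hg|apply HC].
Qed.

Lemma kX_half (t : R) : kX (1 / 2) t = sinh (PI * t) / cosh (PI * t).
Proof.
  assert (h := cosh_ge_1 (PI * t)). unfold kX. rewrite kQ_eq.
  replace (PI * (1 / 2)) with (PI / 2) by field. rewrite sin_PI2.
  replace (sinh (PI * t) ^ 2 + 1 ^ 2) with (cosh (PI * t) ^ 2) by (rewrite cosh_sqr; ring).
  replace (2 * PI * t) with (2 * (PI * t)) by ring. rewrite sinh_double. field. lra.
Qed.

Lemma kX_half_near_1 (t : R) : 0 < t -> Rabs (kX (1 / 2) t - 1) <= / t.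
Proof.
  intros Ht. rewrite kX_half. assert (h := cosh_ge_1 (PI * t)). assert (h0 := PI_RGT_0).
  replace (sinh (PI * t) / cosh (PI * t) - 1) with (- exp (- (PI * t)) / cosh (PI * t)).
  2:{ replace (exp (- (PI * t))) with (cosh (PI * t) - sinh (PI * t)) by (unfold cosh, sinh; field).
      field. lra. }
  apply Rabs_div_le; [lra|]. rewrite Rabs_Ropp, Rabs_pos_eq by (left; apply exp_pos).
  assert (h1 : exp (- (PI * t)) <= 1) by (rewrite <- exp_0; apply exp_mono; nra).
  assert (h2 := cosh_PI_ge t).
  apply Rle_trans with 1; [assumption|].
  apply Rmult_le_reg_l with t; [assumption|]. rewrite <- Rmult_assoc, Rinv_r by lra. nra.
Qed.

(** The factor [1 *] is the constant function to which [expect_succ] is applied when the total mass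
    is propagated along [n]. *)
Lemma int_R_rho1_shift (v : R) : int_R (fun u => 1 * rho1 (u - v)) = 1.
Proof.
  assert (Cr : forall u, continuous (fun u => 1 * rho1 (u - v)) u).
  { intros u. apply (continuous_scal_r 1 (fun u => rho1 (u - v))), continuous_shift', continuous_rho1. }
  assert (Hv := Rabs_pos v). assert (Hv1 := Rle_abs v). assert (Hv2 := Rle_abs (- v)).
  rewrite Rabs_Ropp in Hv2. assert (hv := pow2_ge_0 v).
  apply int_R_eq_of_approx with (4 * (1 + v ^ 2)) 2 (2 * Rabs v + 1).
  - split; [assumption|]. intros u. assert (h := rho1_pos (u - v)).
    rewrite Rabs_pos_eq by lra.
    assert (h1 := rho1_le_lor (u - v)). assert (h2 := lor_mul_le v (u - v)).
    replace (v + (u - v)) with u in h2 by ring.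
    assert (E : lor (u - v) = (1 + v ^ 2) * (lor v * lor (u - v)))
      by (unfold lor at 2; field; lra).
    nra.
  - intros n Hn Hn0.
    assert (E : RInt (fun u => 1 * rho1 (u - v)) (- n) n
      = / 2 * kX (1 / 2) (n - v) - / 2 * kX (1 / 2) (- n - v)).
    { apply is_RInt_unique, (is_RInt_derive (fun u => / 2 * kX (1 / 2) (u - v))).
      - intros u _. evar_last.
        + apply (is_derive_scal (fun u => kX (1 / 2) (u - v))).
          apply (is_derive_shift (kX (1 / 2))), is_derive_kX_r. lra.
        + rewrite kX_half_tanh. simpl. field.
      - intros u _. apply Cr. }
    assert (Eo : kX (1 / 2) (- n - v) = - kX (1 / 2) (n + v)).
    { rewrite !kX_half. replace (PI * (- n - v)) with (- (PI * (n + v))) by ring.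
      rewrite sinh_opp, cosh_opp. unfold Rdiv. ring. }
    assert (K1 := kX_half_near_1 (n - v) ltac:(lra)). assert (K2 := kX_half_near_1 (n + v) ltac:(lra)).
    assert (I1 : / (n - v) <= 2 / n).
    { replace (2 / n) with (/ (n / 2)) by (field; lra). apply Rinv_le_contravar; lra. }
    assert (I2 : / (n + v) <= 2 / n).
    { replace (2 / n) with (/ (n / 2)) by (field; lra). apply Rinv_le_contravar; lra. }
    rewrite E, Eo. apply Rabs_le_between in K1. apply Rabs_le_between in K2. apply Rabs_le. lra.
Qed.

Lemma expect_1 (n : nat) : expect n (fun _ => 1) = 1.
Proof.
  induction n as [|n IH]; [reflexivity|].
  rewrite (expect_succ n 1 (fun _ => 1) (fun _ => 1)); [assumption| | | |].
  - intros. apply continuous_const.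
  - intros. rewrite Rabs_R1. lra.
  - intros. apply continuous_const.
  - intros v. apply int_R_rho1_shift.
Qed.

(** Two nested mean value theorems bound the Taylor remainder by [K (w' - w)^2] uniformly in [u];
    the density then supplies the factor [lor]. *)
Lemma is_derive_expect (n : nat) (f0 f1 f2 : R -> R -> R) (w d K : R) : 0 < d ->
  (forall w' u, Rabs (w' - w) < d -> is_derive (fun s => f0 s u) w' (f1 w' u)) ->
  (forall w' u, Rabs (w' - w) < d -> is_derive (fun s => f1 s u) w' (f2 w' u)) ->
  (forall w' u, Rabs (w' - w) < d -> Rabs (f2 w' u) <= K) ->
  (forall w', Rabs (w' - w) < d -> tame (f0 w')) -> tame (f1 w) ->
  is_derive (fun s => expect n (f0 s)) w (expect n (f1 w)).
Proof.
  intros Hd H1 H2 HK HT0 HT1.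
  destruct n as [|m]; [apply H1; now rewrite Rminus_diag, Rabs_R0|].
  assert (Hin : forall w' c, Rabs (w' - w) < d -> Rmin w w' <= c <= Rmax w w' -> Rabs (c - w) <= Rabs (w' - w)).
  { intros w' c Hw' Hc. revert Hc. unfold Rmin, Rmax. destruct (Rle_dec w w'); intros Hc.
    - rewrite !Rabs_pos_eq; lra.
    - rewrite !Rabs_left1; lra. }
  assert (HT : forall w' u, Rabs (w' - w) < d ->
    Rabs (f0 w' u - f0 w u - (w' - w) * f1 w u) <= K * (w' - w) ^ 2).
  { intros w' u Hw'.
    destruct (MVT_gen (fun s => f0 s u) w w' (fun s => f1 s u)) as (c & Hc & Ec).
    - intros x Hx. apply H1. apply Rle_lt_trans with (2 := Hw'). apply Hin; [assumption|lra].
    - intros x Hx. apply (is_derive_continuity_pt (fun s => f0 s u) x (f1 x u)), H1.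
      apply Rle_lt_trans with (2 := Hw'). now apply Hin.
    - assert (Hcw := Hin w' c Hw' Hc).
      assert (Hcd : Rabs (c - w) < d) by lra.
      destruct (MVT_gen (fun s => f1 s u) w c (fun s => f2 s u)) as (c' & Hc' & Ec').
      + intros x Hx. apply H2. apply Rle_lt_trans with (2 := Hcd). apply Hin; [assumption|lra].
      + intros x Hx. apply (is_derive_continuity_pt (fun s => f1 s u) x (f2 x u)), H2.
        apply Rle_lt_trans with (2 := Hcd). now apply Hin.
      + assert (Hc'd : Rabs (c' - w) < d) by (apply Rle_lt_trans with (2 := Hcd); now apply Hin).
        replace (f0 w' u - f0 w u - (w' - w) * f1 w u) with (f2 c' u * ((c - w) * (w' - w))).
        * rewrite !Rabs_mult, <- (pow2_abs (w' - w)). specialize (HK c' u Hc'd).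
          apply Rmult_le_compat; [apply Rabs_pos|apply Rmult_le_pos; apply Rabs_pos|assumption|].
          simpl. rewrite Rmult_1_r. apply Rmult_le_compat_r; [apply Rabs_pos|assumption].
        * rewrite Ec. transitivity ((f1 c u - f1 w u) * (w' - w)); [rewrite Ec'; ring|ring]. }
  destruct (rho_aux_decaying m) as [C HC].
  apply (is_derive_int_R (fun s u => f0 s u * rho_aux m u) (fun u => f1 w u * rho_aux m u) w d (K * C) Hd).
  - intros w' Hw'. now apply tame_dom, HT0.
  - now apply tame_dom.
  - intros w' u Hw'.
    replace (_ - _) with ((f0 w' u - f0 w u - (w' - w) * f1 w u) * rho_aux m u) by ring.
    assert (h := decaying_ge_0 _ _ HC u). rewrite Rabs_mult, (Rabs_pos_eq (rho_aux m u)) by assumption.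
    replace (K * C * (w' - w) ^ 2 * lor u) with (K * (w' - w) ^ 2 * (C * lor u)) by ring.
    apply Rmult_le_compat; [apply Rabs_pos|assumption|now apply HT|].
    apply Rle_trans with (2 := proj2 (decaying_dom _ _ HC) u). apply Rle_abs.
Qed.

(** * Derivatives and difference equations of [digam] *)

Definition ddpw (w u : R) : R := 2 * w * (w ^ 2 - 3 * u ^ 2) / (w ^ 2 + u ^ 2) ^ 3.
(** [ddpw] and [dddpw] are [2 Re (w + iu)^-3] and [- 6 Re (w + iu)^-4]; the latter bounds the Taylor
    remainder when [digam2] is differentiated. *)
Definition dddpw (w u : R) : R :=
  - (6 * (w ^ 4 - 6 * w ^ 2 * u ^ 2 + u ^ 4)) / (w ^ 2 + u ^ 2) ^ 4.

Lemma is_derive_dpw (w u : R) : w <> 0 -> is_derive (fun w => dpw w u) w (ddpw w u).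
Proof.
  intros H. apply (sum_sqr_pos w u) in H. unfold dpw, ddpw.
  auto_derive; [apply Rgt_not_eq; simpl in H; nra | field; lra].
Qed.

Lemma is_derive_ddpw (w u : R) : w <> 0 -> is_derive (fun w => ddpw w u) w (dddpw w u).
Proof.
  intros H. apply (sum_sqr_pos w u) in H. unfold ddpw, dddpw.
  auto_derive; [|field; lra].
  apply Rgt_not_eq. simpl in H. repeat (apply Rmult_lt_0_compat; [lra|]). lra.
Qed.

(** Of the [i + j] factors of the denominator, [i] absorb the numerator and [j] are bounded below by
    [m^2], which makes the bound uniform in [u]. *)
Lemma Rabs_div_pow_le (m x s k : R) (i j : nat) : 0 < m -> m ^ 2 <= s ->
  Rabs x <= k * s ^ i -> 0 <= k -> Rabs (x / s ^ (i + j)) <= k / (m ^ 2) ^ j.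
Proof.
  intros Hm Hs Hx Hk. assert (Hm2 := pow_lt m 2 Hm). assert (Hs0 : 0 < s) by lra.
  assert (Hmj := pow_lt _ j Hm2). assert (Hsi := pow_lt _ i Hs0).
  apply Rabs_div_le; [now apply pow_lt|].
  apply Rle_trans with (1 := Hx). rewrite pow_add.
  replace (k / (m ^ 2) ^ j * (s ^ i * s ^ j)) with (k * s ^ i * (s ^ j / (m ^ 2) ^ j)) by (field; lra).
  rewrite <- (Rmult_1_r (k * s ^ i)) at 1. apply Rmult_le_compat_l; [nra|].
  apply Rmult_le_reg_r with ((m ^ 2) ^ j); [assumption|].
  replace (s ^ j / (m ^ 2) ^ j * (m ^ 2) ^ j) with (s ^ j) by (field; lra).
  rewrite Rmult_1_l. apply pow_incr. lra.
Qed.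

Lemma dpw_bounded (m w u : R) : 0 < m -> m <= Rabs w -> Rabs (dpw w u) <= 1 / (m ^ 2) ^ 1.
Proof.
  intros Hm Hw. assert (H := sqr_le_sum_sqr m w u Hm Hw).
  apply (Rabs_div_pow_le m _ _ 1 1 1); [assumption|assumption| |lra].
  assert (h := pow2_ge_0 u). assert (h' := pow2_ge_0 w). apply Rabs_le. lra.
Qed.

Lemma ddpw_bounded (m w u : R) : 0 < m -> m <= Rabs w -> Rabs (ddpw w u) <= 6 / m / (m ^ 2) ^ 1.
Proof.
  intros Hm Hw. assert (H := sqr_le_sum_sqr m w u Hm Hw).
  assert (h := pow2_ge_0 u). assert (h' := pow2_ge_0 w). assert (Hi := Rinv_0_lt_compat _ Hm).
  apply (Rabs_div_pow_le m _ _ (6 / m) 2 1); [assumption|assumption| |unfold Rdiv; lra].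
  rewrite !Rabs_mult, (Rabs_pos_eq 2) by lra.
  assert (H1 : Rabs (w ^ 2 - 3 * u ^ 2) <= 3 * (w ^ 2 + u ^ 2)) by (apply Rabs_le; lra).
  assert (H2 : Rabs w <= (w ^ 2 + u ^ 2) / m).
  { apply Rmult_le_reg_r with m; [assumption|]. unfold Rdiv. rewrite Rmult_assoc, Rinv_l by lra.
    rewrite <- (pow2_abs w). nra. }
  replace (6 / m * (w ^ 2 + u ^ 2) ^ 2) with (2 * ((w ^ 2 + u ^ 2) / m) * (3 * (w ^ 2 + u ^ 2)))
    by (field; lra).
  apply Rmult_le_compat; [|apply Rabs_pos| |assumption].
  - assert (h0 := Rabs_pos w). lra.
  - lra.
Qed.

Lemma dddpw_bounded (m w u : R) : 0 < m -> m <= Rabs w -> Rabs (dddpw w u) <= 18 / (m ^ 2) ^ 2.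
Proof.
  intros Hm Hw. assert (H := sqr_le_sum_sqr m w u Hm Hw).
  assert (h := pow2_ge_0 u). assert (h' := pow2_ge_0 w).
  apply (Rabs_div_pow_le m _ _ 18 2 2); [assumption|assumption| |lra].
  rewrite Rabs_Ropp. apply Rabs_le.
  replace (w ^ 4) with ((w ^ 2) ^ 2) by ring. replace (u ^ 4) with ((u ^ 2) ^ 2) by ring.
  set (x := w ^ 2) in *. set (z := u ^ 2) in *. assert (0 <= x * z) by nra.
  assert (0 <= x ^ 2) by apply pow2_ge_0. assert (0 <= z ^ 2) by apply pow2_ge_0. nra.
Qed.

Lemma tame_bounded (f : R -> R) (B : R) : (forall x, continuous f x) ->
  (forall u, Rabs (f u) <= B) -> tame f.
Proof.
  intros Hc HB. split; [assumption|]. exists B. intros u.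
  assert (h := pow2_ge_0 u). assert (h1 := Rabs_pos (f u)). specialize (HB u). nra.
Qed.

Lemma continuous_pw (w u : R) : w <> 0 -> continuous (pw w) u.
Proof. intros H. eapply continuous_of_is_derive. now apply is_derive_pw_r. Qed.

Lemma tame_pw (w : R) : w <> 0 -> tame (pw w).
Proof.
  intros H. apply tame_bounded with (/ Rabs w).
  - intros. now apply continuous_pw.
  - intros. apply pw_bounded; [now apply Rabs_pos_lt|lra].
Qed.

Lemma tame_dpw (w : R) : w <> 0 -> tame (dpw w).
Proof.
  intros H. eapply tame_bounded.
  - intros u. apply (ex_derive_continuous (dpw w)). assert (h := sum_sqr_pos w u H).
    unfold dpw. auto_derive. apply Rgt_not_eq. simpl in h. nra.
  - intros. apply (dpw_bounded (Rabs w)); [now apply Rabs_pos_lt|lra].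
Qed.

Lemma tame_ddpw (w : R) : w <> 0 -> tame (ddpw w).
Proof.
  intros H. eapply tame_bounded.
  - intros u. apply (ex_derive_continuous (ddpw w)). assert (h := sum_sqr_pos w u H).
    unfold ddpw. auto_derive. apply Rgt_not_eq. simpl in h.
    repeat (apply Rmult_lt_0_compat; [lra|]). lra.
  - intros. apply (ddpw_bounded (Rabs w)); [now apply Rabs_pos_lt|lra].
Qed.

Lemma hlog_near (w u : R) : w <> 0 -> 0 <= hlog w u - ln (w ^ 2) / 2 <= u ^ 2 / (2 * w ^ 2).
Proof.
  intros H. assert (Hw := pow2_gt_0 w H). assert (Hs := sum_sqr_pos w u H).
  assert (h := pow2_ge_0 u). assert (hq : 0 <= u ^ 2 / w ^ 2)
    by (apply Rmult_le_pos; [assumption|left; now apply Rinv_0_lt_compat]).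
  assert (E : w ^ 2 + u ^ 2 = w ^ 2 * (1 + u ^ 2 / w ^ 2)) by (field; lra).
  unfold hlog. rewrite E, ln_mult by lra.
  replace (u ^ 2 / (2 * w ^ 2)) with (u ^ 2 / w ^ 2 / 2) by (field; lra).
  set (r := u ^ 2 / w ^ 2) in *.
  assert (h1 : 0 <= ln (1 + r)) by (rewrite <- ln_1; apply Rcomplements.ln_le; lra).
  assert (h2 : ln (1 + r) <= r).
  { rewrite <- (ln_exp r) at 2. apply Rcomplements.ln_le; [lra|apply exp_ineq1_le]. }
  lra.
Qed.

Lemma tame_hlog (w : R) : w <> 0 -> tame (hlog w).
Proof.
  intros H. assert (Hw := pow2_gt_0 w H). split.
  - intros u. eapply continuous_of_is_derive. now apply is_derive_hlog_r.
  - exists (Rabs (ln (w ^ 2) / 2) + / (2 * w ^ 2)). intros u.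
    assert (h := hlog_near w u H). assert (hu := pow2_ge_0 u).
    assert (hi : 0 < / (2 * w ^ 2)) by (apply Rinv_0_lt_compat; lra).
    replace (hlog w u) with (ln (w ^ 2) / 2 + (hlog w u - ln (w ^ 2) / 2)) by ring.
    apply Rle_trans with (1 := Rabs_triang _ _). rewrite (Rabs_pos_eq (hlog w u - _)) by lra.
    assert (ha := Rabs_pos (ln (w ^ 2) / 2)). unfold Rdiv at 3 in h. nra.
Qed.

Lemma tame_const (c : R) : tame (fun _ => c).
Proof. apply tame_bounded with (Rabs c); intros; [apply continuous_const|lra]. Qed.

Lemma tame_minus (f g : R -> R) : tame f -> tame g -> tame (fun u => f u - g u).
Proof.
  intros [Hf [B HB]] [Hg [C HC]]. split.
  - intros x. now apply (continuous_minus f g).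
  - exists (B + C). intros u. apply Rle_trans with (1 := Rabs_triang _ _).
    rewrite Rabs_Ropp. specialize (HB u). specialize (HC u). lra.
Qed.

Lemma tame_scal (k : R) (f : R -> R) : tame f -> tame (fun u => k * f u).
Proof.
  intros [Hf [B HB]]. split.
  - intros x. now apply (continuous_scal_r k f).
  - exists (Rabs k * B). intros u. rewrite Rabs_mult, Rmult_assoc.
    apply Rmult_le_compat_l; [apply Rabs_pos|apply HB].
Qed.

(* For [n = 1] this is the real part of the digamma function at [w + 1/2]; the numbered variants
   are its derivatives. *)
Definition digam (n : nat) (w : R) : R := expect n (hlog w).
Definition digam1 (n : nat) (w : R) : R := expect n (pw w).
Definition digam2 (n : nat) (w : R) : R := expect n (dpw w).
Definition digam3 (n : nat) (w : R) : R := expect n (ddpw w).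

Lemma near_nonzero (w w' : R) : Rabs (w' - w) < Rabs w / 2 -> Rabs w / 2 <= Rabs w'.
Proof.
  intros H. assert (h := Rabs_triang_inv w (w - w')).
  rewrite <- Rabs_Ropp in H. replace (- (w' - w)) with (w - w') in H by ring.
  replace (w - (w - w')) with w' in h by ring. lra.
Qed.

Lemma near_nonzero_neq (w w' : R) : w <> 0 -> Rabs (w' - w) < Rabs w / 2 -> w' <> 0.
Proof.
  intros H0 H. apply near_nonzero in H. assert (h := Rabs_pos_lt w H0).
  intros ->. rewrite Rabs_R0 in H. lra.
Qed.

Lemma is_derive_digam (n : nat) (w : R) : w <> 0 -> is_derive (digam n) w (digam1 n w).
Proof.
  intros H. assert (h := Rabs_pos_lt w H).
  apply (is_derive_expect n hlog pw dpw w (Rabs w / 2) (1 / ((Rabs w / 2) ^ 2) ^ 1)); [lra| | | | |].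
  - intros. apply is_derive_hlog_l. now apply near_nonzero_neq with w.
  - intros. apply is_derive_pw_l. now apply near_nonzero_neq with w.
  - intros. apply dpw_bounded; [lra|now apply near_nonzero].
  - intros. apply tame_hlog. now apply near_nonzero_neq with w.
  - now apply tame_pw.
Qed.

Lemma is_derive_digam1 (n : nat) (w : R) : w <> 0 -> is_derive (digam1 n) w (digam2 n w).
Proof.
  intros H. assert (h := Rabs_pos_lt w H).
  apply (is_derive_expect n pw dpw ddpw w (Rabs w / 2) (6 / (Rabs w / 2) / ((Rabs w / 2) ^ 2) ^ 1));
    [lra| | | | |].
  - intros. apply is_derive_pw_l. now apply near_nonzero_neq with w.
  - intros. apply is_derive_dpw. now apply near_nonzero_neq with w.
  - intros. apply ddpw_bounded; [lra|now apply near_nonzero].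
  - intros. apply tame_pw. now apply near_nonzero_neq with w.
  - now apply tame_dpw.
Qed.

Lemma is_derive_digam2 (n : nat) (w : R) : w <> 0 -> is_derive (digam2 n) w (digam3 n w).
Proof.
  intros H. assert (h := Rabs_pos_lt w H).
  apply (is_derive_expect n dpw ddpw dddpw w (Rabs w / 2) (18 / ((Rabs w / 2) ^ 2) ^ 2)); [lra| | | | |].
  - intros. apply is_derive_dpw. now apply near_nonzero_neq with w.
  - intros. apply is_derive_ddpw. now apply near_nonzero_neq with w.
  - intros. apply dddpw_bounded; [lra|now apply near_nonzero].
  - intros. apply tame_dpw. now apply near_nonzero_neq with w.
  - now apply tame_ddpw.
Qed.

Lemma digam_diff (n : nat) (w : R) : 1 / 2 < w ->
  digam (S n) (w + 1 / 2) - digam (S n) (w - 1 / 2) = digam1 n w.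
Proof.
  intros Hw. unfold digam. rewrite <- expect_minus by (apply tame_hlog; lra).
  apply (expect_succ n (/ (w - 1 / 2)) (hdiff w) (pw w)).
  - intros u. eapply continuous_of_is_derive. now apply is_derive_hdiff.
  - intros u. now apply hdiff_bound.
  - intros v. apply continuous_pw. lra.
  - intros v. now apply int_R_hdiff_rho1.
Qed.

(** An identity on an open half-line may be differentiated; the differentiated identities below are
    obtained in this way. *)
Lemma is_derive_eq_on_right (c w a b : R) (f g : R -> R) : c < w ->
  (forall x, c < x -> f x = g x) -> is_derive f w a -> is_derive g w b -> a = b.
Proof.
  intros Hw H Hf Hg.
  assert (Hf' : is_derive g w a).
  { apply is_derive_ext_loc with f; [|assumption].
    assert (Hp : 0 < w - c) by lra. exists (mkposreal _ Hp). intros t Ht.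
    apply Rabs_lt_between in Ht. unfold minus, plus, opp in Ht; simpl in Ht. apply H. lra. }
  apply is_derive_unique in Hf'. apply is_derive_unique in Hg. now rewrite <- Hf', <- Hg.
Qed.

Lemma is_derive_shift_add (f : R -> R) (c x d : R) : is_derive f (x + c) d ->
  is_derive (fun x => f (x + c)) x d.
Proof.
  intros H. evar_last.
  - apply (is_derive_comp f (fun x => x + c)); [exact H|].
    apply (is_derive_plus (fun x => x) (fun _ => c)); [apply is_derive_id|apply is_derive_const].
  - unfold scal, plus, zero, one; simpl. unfold mult; simpl. ring.
Qed.

Lemma digam1_diff (n : nat) (w : R) : 1 / 2 < w ->
  digam1 (S n) (w + 1 / 2) - digam1 (S n) (w - 1 / 2) = digam2 n w.
Proof.
  intros Hw. eapply (is_derive_eq_on_right (1 / 2) w _ _ _ _ Hw (digam_diff n)).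
  - apply (is_derive_Rminus (fun w => digam (S n) (w + 1 / 2))).
    + apply is_derive_shift_add, is_derive_digam. lra.
    + apply is_derive_shift, is_derive_digam. lra.
  - apply is_derive_digam1. lra.
Qed.

Lemma digam2_diff (n : nat) (w : R) : 1 / 2 < w ->
  digam2 (S n) (w + 1 / 2) - digam2 (S n) (w - 1 / 2) = digam3 n w.
Proof.
  intros Hw. eapply (is_derive_eq_on_right (1 / 2) w _ _ _ _ Hw (digam1_diff n)).
  - apply (is_derive_Rminus (fun w => digam1 (S n) (w + 1 / 2))).
    + apply is_derive_shift_add, is_derive_digam1. lra.
    + apply is_derive_shift, is_derive_digam1. lra.
  - apply is_derive_digam2. lra.
Qed.

(** * The recurrence *)

(** The rate [O(1 / w)], in place of a bare limit, keeps closure under sums, products and shifts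
    elementary. *)
Definition vanishing (f : R -> R) : Prop :=
  exists K W, 0 < W /\ forall w, W <= w -> Rabs (f w) <= K / w.

Lemma vanishing_plus (f g : R -> R) : vanishing f -> vanishing g -> vanishing (fun w => f w + g w).
Proof.
  intros (K & W & HW & H) (K' & W' & HW' & H').
  exists (K + K'), (Rmax W W'). assert (h := Rmax_l W W'). assert (h' := Rmax_r W W').
  split; [lra|]. intros w Hw.
  apply Rle_trans with (1 := Rabs_triang _ _). specialize (H w ltac:(lra)). specialize (H' w ltac:(lra)).
  unfold Rdiv in *. lra.
Qed.

Lemma vanishing_scal (k : R) (f : R -> R) : vanishing f -> vanishing (fun w => k * f w).
Proof.
  intros (K & W & HW & H). exists (Rabs k * K), W. split; [assumption|]. intros w Hw.
  rewrite Rabs_mult. unfold Rdiv. rewrite Rmult_assoc.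
  apply Rmult_le_compat_l; [apply Rabs_pos|now apply H].
Qed.

Lemma vanishing_ext (f g : R -> R) (W : R) : (forall w, W <= w -> f w = g w) ->
  vanishing f -> vanishing g.
Proof.
  intros E (K & W' & HW' & H). exists K, (Rmax W W').
  assert (h := Rmax_l W W'). assert (h' := Rmax_r W W').
  split; [lra|]. intros w Hw. rewrite <- E by lra. apply H. lra.
Qed.

Lemma vanishing_shift (c : R) (f : R -> R) : vanishing f -> vanishing (fun w => f (w + c)).
Proof.
  intros (K & W & HW & H). exists (2 * Rabs K), (W + 2 * Rabs c).
  assert (hc := Rabs_pos c). assert (hc1 := Rle_abs c). assert (hc2 := Rle_abs (- c)).
  rewrite Rabs_Ropp in hc2.
  split; [lra|]. intros w Hw. apply Rle_trans with (1 := H (w + c) ltac:(lra)).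
  apply Rle_trans with (Rabs K / (w + c)).
  - apply Rmult_le_compat_r; [left; apply Rinv_0_lt_compat; lra|apply Rle_abs].
  - replace (2 * Rabs K / w) with (Rabs K / (w / 2)) by (field; lra).
    apply Rmult_le_compat_l; [apply Rabs_pos|]. apply Rinv_le_contravar; lra.
Qed.

Lemma vanishing_of_inv_sqr (f : R -> R) (M : R) : (forall w, 1 <= w -> Rabs (f w) <= M / w ^ 2) ->
  vanishing f.
Proof.
  intros H. exists (Rabs M), 1. split; [lra|]. intros w Hw. apply Rle_trans with (1 := H w Hw).
  apply Rle_trans with (Rabs M / w ^ 2).
  - apply Rmult_le_compat_r; [|apply Rle_abs]. left. apply Rinv_0_lt_compat, pow_lt. lra.
  - apply Rmult_le_compat_l; [apply Rabs_pos|]. apply Rinv_le_contravar; nra.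
Qed.

Lemma vanishing_inv : vanishing (fun w => / w).
Proof.
  exists 1, 1. split; [lra|]. intros w Hw. unfold Rdiv. rewrite Rmult_1_l, Rabs_pos_eq; [lra|].
  left. apply Rinv_0_lt_compat. lra.
Qed.

(** [ln x - ln z <= (x - z) / z], used in both directions; beyond the threshold,
    [w + c >= w / 2]. *)
Lemma vanishing_ln_shift (c : R) : vanishing (fun w => ln (w + c) - ln w).
Proof.
  exists (2 * Rabs c), (1 + 2 * Rabs c).
  assert (hc := Rabs_pos c). assert (hc1 := Rle_abs c). assert (hc2 := Rle_abs (- c)).
  rewrite Rabs_Ropp in hc2.
  split; [lra|]. intros w Hw.
  assert (U : forall x z, 0 < x -> 0 < z -> ln x - ln z <= (x - z) / z).
  { intros x z Hx Hz. rewrite <- ln_div by assumption.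
    rewrite <- (ln_exp ((x - z) / z)). apply Rcomplements.ln_le; [now apply Rdiv_lt_0_compat|].
    replace (x / z) with (1 + (x - z) / z) by (field; lra). apply exp_ineq1_le. }
  assert (U1 := U (w + c) w ltac:(lra) ltac:(lra)).
  assert (U2 := U w (w + c) ltac:(lra) ltac:(lra)).
  replace (w + c - w) with c in U1 by ring. replace (w - (w + c)) with (- c) in U2 by ring.
  assert (V1 : c / w <= 2 * Rabs c / w)
    by (apply Rmult_le_compat_r; [left; apply Rinv_0_lt_compat; lra|lra]).
  assert (V2 : - c / (w + c) <= 2 * Rabs c / w).
  { apply Rle_trans with (Rabs c / (w + c)).
    - apply Rmult_le_compat_r; [left; apply Rinv_0_lt_compat; lra|lra].
    - replace (2 * Rabs c / w) with (Rabs c / (w / 2)) by (field; lra).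
      apply Rmult_le_compat_l; [lra|]. apply Rinv_le_contravar; lra. }
  apply Rabs_le. lra.
Qed.

Lemma vanishing_periodic (f : R -> R) (c : R) : (forall w, c < w -> f (w + 1) = f w) ->
  vanishing f -> forall w, c < w -> f w = 0.
Proof.
  intros P (K & W & HW & H) w Hw.
  assert (PN : forall N : nat, f (w + INR N) = f w).
  { induction N as [|N IH]; [now rewrite Rplus_0_r|].
    rewrite S_INR, <- Rplus_assoc, P; [assumption|]. assert (h := pos_INR N). lra. }
  destruct (Req_dec (f w) 0) as [E|E]; [assumption|exfalso].
  assert (hf := Rabs_pos_lt _ E).
  (* Chosen so that [x = w + (N + 1)] exceeds [W + |K| / |f w|]; there the bound [K / x] is below
     [|f w|], although [f x = f w]. *)
  destruct (nfloor_ex (Rmax 0 (W + Rabs w + Rabs K / Rabs (f w)))) as [N [_ HN]]; [apply Rmax_l|].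
  assert (h1 := Rmax_r 0 (W + Rabs w + Rabs K / Rabs (f w))).
  assert (hK : 0 <= Rabs K / Rabs (f w))
    by (apply Rmult_le_pos; [apply Rabs_pos|left; now apply Rinv_0_lt_compat]).
  assert (hw := Rle_abs (- w)). rewrite Rabs_Ropp in hw.
  specialize (PN (S N)). rewrite S_INR in PN.
  set (x := w + (INR N + 1)) in *.
  assert (hx : W + Rabs K / Rabs (f w) < x) by (unfold x; lra).
  assert (Hx := H x ltac:(lra)). rewrite PN in Hx.
  apply Rmult_le_compat_r with (r := x) in Hx; [|lra].
  replace (K / x * x) with K in Hx by (field; lra).
  assert (hk := Rle_abs K).
  assert (Hy : Rabs K < x * Rabs (f w)).
  { apply Rlt_le_trans with ((W + Rabs K / Rabs (f w)) * Rabs (f w)); [|nra].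
    replace ((W + Rabs K / Rabs (f w)) * Rabs (f w)) with (W * Rabs (f w) + Rabs K) by (field; lra). nra. }
  lra.
Qed.

(** * Behaviour of [digam] and its derivatives at infinity *)

Lemma vanishing_digam (n : nat) : vanishing (fun w => digam n w - ln w).
Proof.
  set (M := expect n (fun u => u ^ 2)).
  apply vanishing_of_inv_sqr with M. intros w Hw.
  assert (Hw2 : 0 < w ^ 2) by (apply pow_lt; lra).
  assert (El : ln w = expect n (fun _ => ln w)).
  { rewrite (expect_ext n (fun _ => ln w) (fun u => ln w * 1)) by (intros; ring).
    rewrite expect_scal by apply tame_const. rewrite expect_1. ring. }
  unfold digam. rewrite El, <- expect_minus by (apply tame_const || (apply tame_hlog; lra)).
  replace (M / w ^ 2) with (/ w ^ 2 * M) by (unfold Rdiv; ring).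
  apply expect_le_sqr.
  - apply tame_minus; [apply tame_hlog; lra|apply tame_const].
  - intros u. assert (h := hlog_near w u ltac:(lra)).
    assert (El2 : ln (w ^ 2) / 2 = ln w).
    { replace (w ^ 2) with (w * w) by ring. rewrite ln_mult by lra. field. }
    rewrite El2 in h. rewrite Rabs_pos_eq by lra. apply Rle_trans with (1 := proj2 h).
    replace (u ^ 2 / (2 * w ^ 2)) with (/ w ^ 2 * u ^ 2 / 2) by (field; lra).
    assert (0 <= / w ^ 2 * u ^ 2)
      by (apply Rmult_le_pos; [left; now apply Rinv_0_lt_compat|apply pow2_ge_0]). lra.
Qed.

Lemma vanishing_digam1 (n : nat) : vanishing (fun w => w * digam1 n w - 1).
Proof.
  set (M := expect n (fun u => u ^ 2)).
  apply vanishing_of_inv_sqr with M. intros w Hw.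
  assert (Hw2 : 0 < w ^ 2) by (apply pow_lt; lra).
  unfold digam1. rewrite <- (expect_1 n), <- expect_scal by (apply tame_pw; lra).
  rewrite <- expect_minus by (apply tame_const || (apply tame_scal, tame_pw; lra)).
  replace (M / w ^ 2) with (/ w ^ 2 * M) by (unfold Rdiv; ring).
  apply expect_le_sqr.
  - apply tame_minus; [apply tame_scal, tame_pw; lra|apply tame_const].
  - intros u. assert (h := sum_sqr_pos w u ltac:(lra)). assert (hu := pow2_ge_0 u).
    replace (w * pw w u - 1) with (- u ^ 2 / (w ^ 2 + u ^ 2)) by (unfold pw; field; lra).
    apply Rabs_div_le; [assumption|]. rewrite Rabs_Ropp, Rabs_pos_eq by assumption.
    replace (/ w ^ 2 * u ^ 2 * (w ^ 2 + u ^ 2)) with (u ^ 2 + / w ^ 2 * (u ^ 2 * u ^ 2)) by (field; lra).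
    assert (0 <= / w ^ 2 * (u ^ 2 * u ^ 2))
      by (apply Rmult_le_pos; [left; now apply Rinv_0_lt_compat|nra]). lra.
Qed.

Lemma vanishing_digam2 (n : nat) : vanishing (fun w => w ^ 2 * digam2 n w + 1).
Proof.
  set (M := expect n (fun u => u ^ 2)).
  apply vanishing_of_inv_sqr with (3 * M). intros w Hw.
  assert (Hw2 : 0 < w ^ 2) by (apply pow_lt; lra).
  unfold digam2. rewrite <- expect_scal by (apply tame_dpw; lra).
  replace (expect n (fun u => w ^ 2 * dpw w u) + 1)
    with (expect n (fun u => w ^ 2 * dpw w u) - -1 * expect n (fun _ => 1)) by (rewrite expect_1; ring).
  rewrite <- expect_scal by apply tame_const.
  rewrite <- expect_minus by (apply tame_scal, tame_const || (apply tame_scal, tame_dpw; lra)).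
  replace (3 * M / w ^ 2) with (3 / w ^ 2 * M) by (unfold Rdiv; ring).
  apply expect_le_sqr.
  - apply tame_minus; [apply tame_scal, tame_dpw; lra|apply tame_scal, tame_const].
  - intros u. assert (h := sum_sqr_pos w u ltac:(lra)). assert (hu := pow2_ge_0 u).
    replace (w ^ 2 * dpw w u - -1 * 1) with (u ^ 2 * (3 * w ^ 2 + u ^ 2) / (w ^ 2 + u ^ 2) ^ 2)
      by (unfold dpw; field; lra).
    apply Rabs_div_le; [now apply pow_lt|]. rewrite Rabs_pos_eq by nra.
    replace (3 / w ^ 2 * u ^ 2 * (w ^ 2 + u ^ 2) ^ 2)
      with (u ^ 2 * (3 * w ^ 2 + 6 * u ^ 2 + 3 * / w ^ 2 * (u ^ 2 * u ^ 2))) by (field; lra).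
    apply Rmult_le_compat_l; [assumption|].
    assert (0 <= / w ^ 2 * (u ^ 2 * u ^ 2))
      by (apply Rmult_le_pos; [left; now apply Rinv_0_lt_compat|nra]). lra.
Qed.

Lemma vanishing_digam_shift (n : nat) (c : R) : vanishing (fun w => digam n (w + c) - ln w).
Proof.
  apply vanishing_ext with (fun w => (digam n (w + c) - ln (w + c)) + (ln (w + c) - ln w)) 0.
  - intros. ring.
  - apply vanishing_plus; [apply (vanishing_shift c _ (vanishing_digam n))|apply vanishing_ln_shift].
Qed.

Lemma vanishing_mul (f g : R -> R) : vanishing f -> vanishing g -> vanishing (fun w => f w * g w).
Proof.
  intros (K & W & HW & H) (K' & W' & HW' & H').
  exists (Rabs K * Rabs K'), (1 + Rmax W W'). assert (h := Rmax_l W W'). assert (h' := Rmax_r W W').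
  split; [lra|]. intros w Hw.
  specialize (H w ltac:(lra)). specialize (H' w ltac:(lra)).
  assert (hi : 0 < / w) by (apply Rinv_0_lt_compat; lra).
  assert (hi1 : / w <= 1) by (rewrite <- Rinv_1; apply Rinv_le_contravar; lra).
  assert (hk := Rle_abs K). assert (hk' := Rle_abs K').
  assert (hp := Rabs_pos K). assert (hp' := Rabs_pos K').
  unfold Rdiv in *. rewrite Rabs_mult.
  apply Rle_trans with ((Rabs K * / w) * (Rabs K' * 1)).
  - apply Rmult_le_compat; auto using Rabs_pos; nra.
  - right. ring.
Qed.

Lemma vanishing_digam1_0 (n : nat) : vanishing (digam1 n).
Proof.
  apply vanishing_ext with (fun w => / w * (w * digam1 n w - 1) + / w) 1.
  - intros w Hw. field. lra.
  - apply vanishing_plus; [apply vanishing_mul|]; auto using vanishing_inv, vanishing_digam1.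
Qed.

Lemma vanishing_digam2_0 (n : nat) : vanishing (digam2 n).
Proof.
  apply vanishing_ext with (fun w => / w * / w * (w ^ 2 * digam2 n w + 1) + -1 * (/ w * / w)) 1.
  - intros w Hw. field. lra.
  - apply vanishing_plus; [|apply vanishing_scal];
      repeat apply vanishing_mul; auto using vanishing_inv, vanishing_digam2.
Qed.

Lemma vanishing_digam1_shift (n : nat) (c : R) : vanishing (fun w => w * digam1 n (w + c) - 1).
Proof.
  apply vanishing_ext with
    (fun w => ((w + c) * digam1 n (w + c) - 1) + - c * digam1 n (w + c)) 0.
  - intros. ring.
  - apply vanishing_plus; [apply (vanishing_shift c _ (vanishing_digam1 n))|].
    apply vanishing_scal, vanishing_shift, vanishing_digam1_0.
Qed.

(** * The two first-order relations and the recurrence *)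

Lemma pw_0 (w : R) : w <> 0 -> pw w 0 = / w.
Proof. intros. unfold pw. field. auto. Qed.

Lemma dpw_0 (w : R) : w <> 0 -> dpw w 0 = - / w ^ 2.
Proof. intros. unfold dpw. field. auto. Qed.

Definition mean (f : R -> R) (w : R) : R := (f (w + 1 / 2) + f (w - 1 / 2)) / 2.

Lemma is_derive_mean (f f' : R -> R) (w : R) :
  is_derive f (w + 1 / 2) (f' (w + 1 / 2)) -> is_derive f (w - 1 / 2) (f' (w - 1 / 2)) ->
  is_derive (mean f) w (mean f' w).
Proof.
  intros H1 H2. unfold mean. evar_last.
  - apply (is_derive_ext (fun w => / 2 * (f (w + 1 / 2) + f (w - 1 / 2)))).
    { intros t. apply Rmult_comm. }
    apply (is_derive_scal (fun w => f (w + 1 / 2) + f (w - 1 / 2))).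
    apply (is_derive_Rplus (fun w => f (w + 1 / 2))).
    + apply is_derive_shift_add, H1.
    + apply is_derive_shift, H2.
  - apply Rmult_comm.
Qed.

(** Stated as an implication because the induction in [digam_mean] differentiates its own induction
    hypothesis. *)
Lemma digam1_mean_of (n : nat) :
  (forall w, 1 / 2 < w ->
    INR n * mean (digam (S n)) w = INR n * digam n w + w * digam1 n w - 1) ->
  forall w, 1 / 2 < w ->
  INR n * mean (digam1 (S n)) w = (INR n + 1) * digam1 n w + w * digam2 n w.
Proof.
  intros J w Hw. apply (is_derive_eq_on_right (1 / 2) w _ _ _ _ Hw J).
  - apply (is_derive_scal (mean (digam (S n)))).
    apply is_derive_mean; apply is_derive_digam; lra.
  - evar_last.
    + apply (is_derive_Rminus (fun w => INR n * digam n w + w * digam1 n w) (fun _ => 1));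
        [|apply is_derive_const].
      apply (is_derive_Rplus (fun w => INR n * digam n w)).
      * apply (is_derive_scal (digam n)), is_derive_digam. lra.
      * apply (is_derive_Rmult (fun w => w) (digam1 n)); [apply is_derive_id|].
        apply is_derive_digam1. lra.
    + unfold zero, one; simpl. ring.
Qed.

(* In Fourier terms: [s phi_n' = n (phi_n - cosh(s) phi_{n+1})] for [phi_n = (s / sinh s)^n]. *)
Lemma digam_mean (n : nat) (w : R) : 1 / 2 < w ->
  INR n * mean (digam (S n)) w = INR n * digam n w + w * digam1 n w - 1.
Proof.
  revert w. induction n as [|n IH]; intros w Hw.
  - unfold digam1. simpl. rewrite pw_0 by lra. field. lra.
  - set (f := fun w => INR (S n) * mean (digam (S (S n))) w
      - INR (S n) * digam (S n) w - (w * digam1 (S n) w - 1)).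
    enough (f w = 0) by (unfold f in *; lra).
    apply (vanishing_periodic f (1 / 2)); [| |assumption]; clear w Hw.
    (* The discrete product rule [(c + 1/2) h (c + 1/2) - (c - 1/2) h (c - 1/2) = c (h (c + 1/2) - h
       (c - 1/2)) + mean h c] with [h = digam1 (S n)] removes one of the [n + 1] means in
       [f (w + 1) - f w]. What is left is the differentiated induction hypothesis [Ec]. *)
    + intros w Hw. set (c := w + 1 / 2).
      assert (Ec := digam1_mean_of n IH c ltac:(unfold c; lra)).
      assert (D1 := digam_diff (S n) (c + 1 / 2) ltac:(unfold c; lra)).
      assert (D2 := digam_diff (S n) (c - 1 / 2) ltac:(unfold c; lra)).
      assert (D3 := digam_diff n c ltac:(unfold c; lra)).
      assert (D4 := digam1_diff n c ltac:(unfold c; lra)).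
      unfold f, mean in *. rewrite !S_INR.
      replace (w + 1 + 1 / 2) with (c + 1 / 2 + 1 / 2) by (unfold c; lra).
      replace (w + 1 - 1 / 2) with c by (unfold c; lra).
      replace (w + 1 / 2) with c by (unfold c; lra).
      replace (w - 1 / 2) with (c - 1 / 2 - 1 / 2) by (unfold c; lra).
      replace (w + 1) with (c + 1 / 2) by (unfold c; lra).
      replace w with (c - 1 / 2) by (unfold c; lra).
      replace (c + 1 / 2 - 1 / 2) with c in D1 by ring.
      replace (c - 1 / 2 + 1 / 2) with c in D2 by ring.
      assert (D1' := f_equal (Rmult (INR n)) D1). assert (D2' := f_equal (Rmult (INR n)) D2).
      assert (D3' := f_equal (Rmult (INR n)) D3). assert (D4' := f_equal (Rmult c) D4).
      lra.
    (* The coefficients of [ln w] add up to 0, and the constant 1 is the limit of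
       [w * digam1 (S n) w]. *)
    + apply vanishing_ext with (fun w => INR (S n) / 2 * (digam (S (S n)) (w + 1 / 2) - ln w)
        + (INR (S n) / 2 * (digam (S (S n)) (w + - (1 / 2)) - ln w)
        + (- INR (S n) * (digam (S n) w - ln w) + -1 * (w * digam1 (S n) w - 1)))) 1.
      * intros w Hw. unfold f, mean. change (w - 1 / 2) with (w + - (1 / 2)). field.
      * repeat apply vanishing_plus; apply vanishing_scal;
          auto using vanishing_digam_shift, vanishing_digam, vanishing_digam1.
Qed.

Lemma digam1_mean (n : nat) (w : R) : 1 / 2 < w ->
  INR n * mean (digam1 (S n)) w = (INR n + 1) * digam1 n w + w * digam2 n w.
Proof. apply digam1_mean_of, digam_mean. Qed.

Lemma digam2_mean (n : nat) (w : R) : 1 / 2 < w ->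
  INR n * mean (digam2 (S n)) w = (INR n + 2) * digam2 n w + w * digam3 n w.
Proof.
  intros Hw. apply (is_derive_eq_on_right (1 / 2) w _ _ _ _ Hw (digam1_mean n)).
  - apply (is_derive_scal (mean (digam1 (S n)))).
    apply is_derive_mean; apply is_derive_digam1; lra.
  - evar_last.
    + apply (is_derive_Rplus (fun w => (INR n + 1) * digam1 n w)).
      * apply (is_derive_scal (digam1 n)), is_derive_digam1. lra.
      * apply (is_derive_Rmult (fun w => w) (digam2 n)); [apply is_derive_id|].
        apply is_derive_digam2. lra.
    + unfold one; simpl. ring.
Qed.

(** An implication again: it is applied to the induction hypothesis of [digam_succ], and later to
    [digam_succ] itself. *)
Lemma digam1_succ_of (m : nat) :
  (forall w, 1 / 2 < w -> (INR m + 1) * digam (S (S m)) w =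
    (INR m + 1) * mean (digam (S m)) w + w * mean (digam1 (S m)) w - INR m / 4 * digam2 m w - 1) ->
  forall w, 1 / 2 < w -> (INR m + 1) * digam1 (S (S m)) w =
    (INR m + 2) * mean (digam1 (S m)) w + w * mean (digam2 (S m)) w - INR m / 4 * digam3 m w.
Proof.
  intros K w Hw. apply (is_derive_eq_on_right (1 / 2) w _ _ _ _ Hw K).
  - apply (is_derive_scal (digam (S (S m)))), is_derive_digam. lra.
  - evar_last.
    + apply (is_derive_Rminus (fun w => (INR m + 1) * mean (digam (S m)) w + w * mean (digam1 (S m)) w
        - INR m / 4 * digam2 m w) (fun _ => 1)); [|apply is_derive_const].
      apply (is_derive_Rminus (fun w => (INR m + 1) * mean (digam (S m)) w + w * mean (digam1 (S m)) w)).
      * apply (is_derive_Rplus (fun w => (INR m + 1) * mean (digam (S m)) w)).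
        -- apply (is_derive_scal (mean (digam (S m)))).
           apply is_derive_mean; apply is_derive_digam; lra.
        -- apply (is_derive_Rmult (fun w => w) (mean (digam1 (S m)))); [apply is_derive_id|].
           apply is_derive_mean; apply is_derive_digam1; lra.
      * apply (is_derive_scal (digam2 m)), is_derive_digam2. lra.
    + unfold zero, one; simpl. ring.
Qed.

(* Formally [mean] applied to [digam_mean], since [mean (mean f) = f + diff (diff f) / 4];
   periodicity yields it on the whole half-line [w > 1/2]. *)
Lemma digam_succ (m : nat) (w : R) : 1 / 2 < w ->
  (INR m + 1) * digam (S (S m)) w =
    (INR m + 1) * mean (digam (S m)) w + w * mean (digam1 (S m)) w - INR m / 4 * digam2 m w - 1.
Proof.
  revert w. induction m as [|k IH]; intros w Hw;
    (* The decay of the defect is common to both cases. Its periodicity uses explicit functions for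
       [m = 0], where the density is a Dirac mass, and the differentiated induction hypothesis for
       [m = S k]. *)
    [set (m := O)|set (m := S k)];
    set (f := fun w => (INR m + 1) * (digam (S (S m)) w - mean (digam (S m)) w)
      - w * mean (digam1 (S m)) w + INR m / 4 * digam2 m w + 1);
    (enough (f w = 0) by (unfold f in *; lra));
    (apply (vanishing_periodic f (1 / 2)); [| |assumption]); clear w Hw.
  all: match goal with
    | |- vanishing _ =>
      apply vanishing_ext with (fun w => (INR m + 1) * (digam (S (S m)) w - ln w)
        + (- (INR m + 1) / 2 * (digam (S m) (w + 1 / 2) - ln w)
        + (- (INR m + 1) / 2 * (digam (S m) (w + - (1 / 2)) - ln w)
        + (- / 2 * (w * digam1 (S m) (w + 1 / 2) - 1)
        + (- / 2 * (w * digam1 (S m) (w + - (1 / 2)) - 1)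
        + INR m / 4 * digam2 m w))))) 1;
      [intros w Hw; unfold f, mean; change (w - 1 / 2) with (w + - (1 / 2)); field
      |repeat apply vanishing_plus; apply vanishing_scal;
       auto using vanishing_digam_shift, vanishing_digam, vanishing_digam1_shift, vanishing_digam2_0]
    | _ => idtac
    end.
  all: intros w Hw; set (c := w + 1 / 2);
    assert (D1 := digam_diff (S m) c ltac:(unfold c; lra));
    assert (D2 := digam_diff m (c + 1 / 2) ltac:(unfold c; lra));
    assert (D3 := digam_diff m (c - 1 / 2) ltac:(unfold c; lra));
    assert (D4 := digam1_diff m (c + 1 / 2) ltac:(unfold c; lra));
    assert (D5 := digam1_diff m (c - 1 / 2) ltac:(unfold c; lra));
    unfold f, mean;
    replace (w + 1 + 1 / 2) with (c + 1 / 2 + 1 / 2) by (unfold c; lra);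
    replace (w + 1 - 1 / 2) with c by (unfold c; lra);
    replace (w + 1 / 2) with c by (unfold c; lra);
    replace (w - 1 / 2) with (c - 1 / 2 - 1 / 2) by (unfold c; lra);
    replace (w + 1) with (c + 1 / 2) by (unfold c; lra);
    replace w with (c - 1 / 2) by (unfold c; lra);
    replace (c + 1 / 2 - 1 / 2) with c in D2, D4 by ring;
    replace (c - 1 / 2 + 1 / 2) with c in D3, D5 by ring;
    assert (D1' := f_equal (Rmult (INR m)) D1); assert (D2' := f_equal (Rmult (INR m)) D2);
    assert (D3' := f_equal (Rmult (INR m)) D3);
    assert (D4' := f_equal (Rmult c) D4); assert (D5' := f_equal (Rmult c) D5).
  - assert (Hc : 1 < c) by (unfold c; lra).
    assert (E1 : forall x, x <> 0 -> digam1 m x = / x) by (intros; now apply pw_0).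
    assert (E2 : forall x, x <> 0 -> digam2 m x = - / x ^ 2) by (intros; now apply dpw_0).
    (* For the Dirac mass [w * digam1 0 w] is constant. Its derivative vanishes at [c + 1/2] and at
       [c - 1/2], and half the sum of the two equations is the required periodicity. *)
    assert (Q1 : digam1 m (c + 1 / 2) + (c + 1 / 2) * digam2 m (c + 1 / 2) = 0)
      by (rewrite E1, E2 by lra; field; lra).
    assert (Q2 : digam1 m (c - 1 / 2) + (c - 1 / 2) * digam2 m (c - 1 / 2) = 0)
      by (rewrite E1, E2 by lra; field; lra).
    simpl (INR m) in *. lra.
  (* The double mean of [digam1 (S m)] is its value plus a quarter of its second difference; this
     lowers the coefficient [m / 4] to [(m - 1) / 4], that of the induction hypothesis at
     [k = m - 1]. *)
  - assert (Ek := digam1_succ_of k IH c ltac:(unfold c; lra)).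
    assert (D6 := digam2_diff k c ltac:(unfold c; lra)). fold m in Ek, D6. unfold mean in Ek.
    assert (Em : INR m = INR k + 1) by apply S_INR.
    replace (INR k) with (INR m - 1) in Ek by lra.
    assert (D6' := f_equal (Rmult (INR m)) D6).
    lra.
Qed.

(** In the unit difference of the defect, the differentiated [digam_succ] eliminates
    [digam1 (S (S m))], and [digam1_mean] and [digam2_mean] eliminate the means at level [S m].
    Everything then lives at level [m] and cancels. The centre [c = w + 1/2] exceeds [1/2] for every
    [w > 0]. *)
Lemma digam_recurrence (m : nat) (w : R) : 0 < w -> let N := INR (S m) in
  N * (N + 1) * digam (S (S (S m))) w =
    (w ^ 2 - N ^ 2 / 4) * digam2 (S m) w + 2 * (N + 1) * w * digam1 (S m) w
    + N * (N + 1) * digam (S m) w - (2 * N + 1).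
Proof.
  intros Hw N.
  set (f := fun w => N * (N + 1) * (digam (S (S (S m))) w - digam (S m) w)
    - (w ^ 2 - N ^ 2 / 4) * digam2 (S m) w - 2 * (N + 1) * w * digam1 (S m) w + (2 * N + 1)).
  enough (f w = 0) by (unfold f in *; lra).
  apply (vanishing_periodic f 0); [| |assumption]; clear w Hw.
  - intros w Hw. set (c := w + 1 / 2). assert (Hc : 1 / 2 < c) by (unfold c; lra).
    assert (EN : N = INR m + 1) by apply S_INR.
    assert (D1 := digam_diff (S (S m)) c Hc). assert (D2 := digam_diff m c Hc).
    assert (D3 := digam1_diff m c Hc). assert (D4 := digam2_diff m c Hc).
    assert (K := digam1_succ_of m (digam_succ m) c Hc).
    assert (J1 := digam1_mean m c Hc). assert (J2 := digam2_mean m c Hc).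
    unfold mean in *. unfold f.
    replace (w + 1) with (c + 1 / 2) by (unfold c; lra).
    replace w with (c - 1 / 2) by (unfold c; lra).
    set (a1 := digam1 (S m) (c + 1 / 2)) in *. set (b1 := digam1 (S m) (c - 1 / 2)) in *.
    set (a2 := digam2 (S m) (c + 1 / 2)) in *. set (b2 := digam2 (S m) (c - 1 / 2)) in *.
    replace (INR m) with (N - 1) in * by lra.
    assert (X1 : N * (N + 1) * (digam (S (S (S m))) (c + 1 / 2) - digam (S (S (S m))) (c - 1 / 2))
      = (N + 1) * (N * digam1 (S (S m)) c)) by (rewrite D1; ring).
    assert (X2 : N * (N + 1) * (digam (S m) (c + 1 / 2) - digam (S m) (c - 1 / 2))
      = N * (N + 1) * digam1 m c) by (rewrite D2; ring).
    replace (N * digam1 (S (S m)) c) with ((N - 1 + 1) * digam1 (S (S m)) c) in X1 by ring.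
    rewrite K in X1.
    (* The quadratic coefficient contributes [(c^2 + 1/4 - N^2 / 4) * digam3 m c]: the term [c^2]
       meets [Y2], and [(N^2 - 1) / 4] meets the last term of [K] multiplied by [N + 1]. *)
    assert (Y1 := f_equal (Rmult (N + 1)) J1). assert (Y2 := f_equal (Rmult c) J2).
    assert (Z1 := f_equal (Rmult (c * (N + 1))) D3). assert (Z2 := f_equal (Rmult (c ^ 2)) D4).
    assert (Z3 := f_equal (Rmult (N ^ 2)) D4). assert (Z4 := f_equal (Rmult (N + 1)) D3).
    lra.
  (* The constant is [2 N + 1 = 2 (N + 1) - 1], from the limits 1 of [w * digam1] and -1 of
     [w^2 * digam2]; the logarithms cancel. *)
  - apply vanishing_ext with (fun w => N * (N + 1) * (digam (S (S (S m))) w - ln w)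
      + (- (N * (N + 1)) * (digam (S m) w - ln w)
      + (-1 * (w ^ 2 * digam2 (S m) w + 1)
      + (N ^ 2 / 4 * digam2 (S m) w
      + - (2 * (N + 1)) * (w * digam1 (S m) w - 1))))) 1.
    + intros w Hw. unfold f. field.
    + repeat apply vanishing_plus; apply vanishing_scal;
        auto using vanishing_digam, vanishing_digam1, vanishing_digam2, vanishing_digam2_0.
Qed.

(** * Negative [w], and the return from [digam] to [y] *)

Lemma digam_opp (n : nat) (w : R) : digam n (- w) = digam n w.
Proof. apply expect_ext. intros u. unfold hlog. now replace ((- w) ^ 2) with (w ^ 2) by ring. Qed.

Lemma digam1_opp (n : nat) (w : R) : w <> 0 -> digam1 n (- w) = - digam1 n w.
Proof.
  intros H. transitivity (-1 * digam1 n w); [|ring].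
  unfold digam1. rewrite <- expect_scal by now apply tame_pw.
  apply expect_ext. intros u. unfold pw. replace ((- w) ^ 2) with (w ^ 2) by ring.
  unfold Rdiv. ring.
Qed.

Lemma digam2_opp (n : nat) (w : R) : digam2 n (- w) = digam2 n w.
Proof. apply expect_ext. intros u. unfold dpw. now replace ((- w) ^ 2) with (w ^ 2) by ring. Qed.

Lemma digam_recurrence_nonzero (m : nat) (w : R) : w <> 0 -> let N := INR (S m) in
  N * (N + 1) * digam (S (S (S m))) w =
    (w ^ 2 - N ^ 2 / 4) * digam2 (S m) w + 2 * (N + 1) * w * digam1 (S m) w
    + N * (N + 1) * digam (S m) w - (2 * N + 1).
Proof.
  intros Hw N. destruct (Rlt_dec 0 w) as [H|H]; [now apply digam_recurrence|].
  assert (E := digam_recurrence m (- w) ltac:(lra)). fold N in E. cbv zeta in E.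
  rewrite !digam_opp, digam1_opp, digam2_opp in E by assumption.
  replace ((- w) ^ 2) with (w ^ 2) in E by ring. lra.
Qed.

Lemma y_eq_digam (m : nat) (x : R) : x <> INR (S m) / 2 ->
  y (S m) x = digam (S m) (x - INR (S m) / 2) - ln ((x - INR (S m) / 2) ^ 2) / 2.
Proof.
  intros Hx. unfold y, z. set (w := x - INR (S m) / 2).
  assert (Hw : w <> 0) by (unfold w; lra). assert (Hw2 := pow2_gt_0 w Hw).
  destruct (rho_aux_decaying m) as [C HC].
  (* The factor 2 is compensated by the half-line: the integrand is even, and [is_RInt_gen_half]
     halves its full integral. *)
  set (g := fun u => 2 * (hlog w u - ln (w ^ 2) / 2)).
  assert (Eg : forall u, ln (1 + / w ^ 2 * u ^ 2) = g u).
  { intros u. assert (h := pow2_ge_0 u).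
    assert (hi : 0 <= / w ^ 2 * u ^ 2) by (apply Rmult_le_pos; [left; now apply Rinv_0_lt_compat|assumption]).
    unfold g, hlog. replace (w ^ 2 + u ^ 2) with (w ^ 2 * (1 + / w ^ 2 * u ^ 2)) by (field; lra).
    rewrite ln_mult by lra. field. }
  assert (Tg : tame g).
  { apply tame_scal, tame_minus; [now apply tame_hlog|apply tame_const]. }
  destruct (tame_dom g m Tg) as [B HB].
  apply is_RInt_gen_unique.
  replace (fun u => ln (1 + / w ^ 2 * u ^ 2) * rho (S m) u) with (fun u => g u * rho_aux m u)
    by (apply functional_extensionality; intros u; now rewrite Eg).
  replace (digam (S m) w - ln (w ^ 2) / 2) with (int_R (fun u => g u * rho_aux m u) / 2).
  - apply is_RInt_gen_half with B; [assumption|]. intros u.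
    rewrite (decaying_even _ _ HC). f_equal. unfold g, hlog. now replace ((- u) ^ 2) with (u ^ 2) by ring.
  - change (expect (S m) g / 2 = digam (S m) w - ln (w ^ 2) / 2).
    unfold g. rewrite expect_scal by (apply tame_minus; [now apply tame_hlog|apply tame_const]).
    rewrite expect_minus by (apply tame_const || now apply tame_hlog).
    rewrite (expect_ext _ (fun _ => ln (w ^ 2) / 2) (fun _ => ln (w ^ 2) / 2 * 1)) by (intros; ring).
    rewrite expect_scal, expect_1 by apply tame_const. unfold digam. field.
Qed.

Lemma locally_neq (x a : R) : x <> a -> locally x (fun t => t <> a).
Proof.
  intros H. assert (h : 0 < Rabs (x - a)) by (apply Rabs_pos_lt; lra).
  exists (mkposreal _ h). intros t Ht ->.
  change (Rabs (a - x) < Rabs (x - a)) in Ht. rewrite Rabs_minus_sym in Ht. lra.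
Qed.

Lemma is_derive_y (m : nat) (x : R) : x <> INR (S m) / 2 ->
  is_derive (y (S m)) x (digam1 (S m) (x - INR (S m) / 2) - / (x - INR (S m) / 2)).
Proof.
  intros Hx. assert (Hw : x - INR (S m) / 2 <> 0) by lra.
  apply is_derive_ext_loc with
    (fun x => digam (S m) (x - INR (S m) / 2) - ln ((x - INR (S m) / 2) ^ 2) / 2).
  - apply filter_imp with (2 := locally_neq _ _ Hx). intros t Ht. symmetry. now apply y_eq_digam.
  - apply (is_derive_Rminus (fun x => digam (S m) (x - INR (S m) / 2))).
    + apply is_derive_shift, is_derive_digam, Hw.
    + apply (is_derive_shift (fun w => ln (w ^ 2) / 2)). revert Hw.
      generalize (x - INR (S m) / 2). intros w Hw. assert (h := pow2_gt_0 _ Hw).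
      auto_derive; [simpl in h |- *; lra|field; assumption].
Qed.

Lemma is_derive_Derive_y (m : nat) (x : R) : x <> INR (S m) / 2 ->
  is_derive (Derive (y (S m))) x (digam2 (S m) (x - INR (S m) / 2) + / (x - INR (S m) / 2) ^ 2).
Proof.
  intros Hx. assert (Hw : x - INR (S m) / 2 <> 0) by lra.
  apply is_derive_ext_loc with
    (fun x => digam1 (S m) (x - INR (S m) / 2) - / (x - INR (S m) / 2)).
  - apply filter_imp with (2 := locally_neq _ _ Hx). intros t Ht. symmetry.
    now apply is_derive_unique, is_derive_y.
  - evar_last.
    + apply (is_derive_Rminus (fun x => digam1 (S m) (x - INR (S m) / 2))).
      * apply is_derive_shift, is_derive_digam1, Hw.
      * apply (is_derive_shift Rinv), (is_derive_inv (fun w => w)); [apply is_derive_id|exact Hw].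
    + revert Hw. generalize (x - INR (S m) / 2). intros w Hw.
      change one with 1. field. exact Hw.
Qed.

Theorem theorem4p7 (l : nat) (x : R) :
  (1 <= l)%nat -> x <> INR l / 2 ->
  INR l * INR (l + 1) * y (l + 2) (x + 1) =
    x * (x - INR l) * Derive_n (y l) 2 x
    + 2 * INR (l + 1) * (x - INR l / 2) * Derive (y l) x
    + INR l * INR (l + 1) * y l x
    + INR l ^ 2 / (4 * (x - INR l / 2) ^ 2).
Proof.
  intros Hl Hx. destruct l as [|m]; [lia|].
  change (Derive_n (y (S m)) 2 x) with (Derive (Derive (y (S m))) x).
  rewrite (is_derive_unique _ _ _ (is_derive_Derive_y m x Hx)).
  rewrite (is_derive_unique _ _ _ (is_derive_y m x Hx)).
  replace (S m + 2)%nat with (S (S (S m))) by lia.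
  assert (EN : INR (S (S (S m))) = INR (S m) + 2) by (rewrite !S_INR; ring).
  rewrite !y_eq_digam by lra.
  replace (x + 1 - INR (S (S (S m))) / 2) with (x - INR (S m) / 2) by lra.
  rewrite plus_INR. change (INR 1) with 1.
  set (w := x - INR (S m) / 2). set (N := INR (S m)) in *.
  assert (Hw : w <> 0) by (unfold w; lra).
  assert (E := digam_recurrence_nonzero m w Hw). fold N in E. cbv zeta in E.
  (* Now [x (x - N) = w^2 - N^2 / 4], and the derivatives of [- ln |w|] contribute
     [1 - N^2 / (4 w^2) - 2 (N + 1)]: the constants give [- (2 N + 1)], and the rational part is
     cancelled by the last term of the claim. *)
  replace x with (w + N / 2) by (unfold w; lra).
  rewrite Rmult_minus_distr_l, E. field. exact Hw.
Qed.
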